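(* Let $R$ be a perfectoid ring of characteristic $0$. Then the tilting operation $J\mapsto J^{\flat}$ and the untilting operation $I\mapsto I^{\sharp}$ define a one-to-one correspondence (i.e. are mutually inverse bijections) between the set of perfectoid ideals of $R$ and the set of $p^{\flat}$-adically closed radical ideals of $R^{\flat}$.
   Context: Fix a prime number $p$. Perfectoid rings are meant in the (integral) sense of Bhatt–Morrow–Scholze: a ring $R$ is perfectoid if there is $\pi\in R$ such that $R$ is $\pi$-adically complete (and separated), $\pi^p$ divides $p$ in $R$, the Frobenius on $R/pR$ is surjective, and the kernel of the theta map $\theta_R\colon W(R^{\flat})\to R$, $\sum_{n\ge 0}[x_n]p^n\mapsto\sum_{n\ge 0}x_n^{\sharp}p^n$, is principal. An ideal $J$ of a perfectoid ring $R$ is a perfectoid ideal if $R/J$ is a perfectoid ring. For a $p$-adically complete ring $R$, the tilt is $R^{\flat}:=\varprojlim_F R/pR$ ($F$ the Frobenius), whose underlying multiplicative monoid is identified with $\varprojlim_{x\mapsto x^p}R$, so elements of $R^{\flat}$ are sequences $x=(x^{(n)})_{n\ge 0}$ in $R$ with $(x^{(n+1)})^p=x^{(n)}$; $x^{\sharp}:=x^{(0)}$. For a perfectoid ring $R$ of characteristic $0$ there is a unit $v\in R^{\times}$ such that $vp$ admits a compatible system of $p$-power roots in $R$; one fixes such a system and lets $p^{\flat}:=((vp)^{1/p^n})_n\in R^{\flat}$ be the corresponding element. An ideal of a ring $B$ is $a$-adically closed ($a\in B$) if it is a closed subset of $B$ in the $a$-adic topology. Tilt of an ideal $J\subseteq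 R$: $J^{\flat}:=\{x=(x^{(n)})_n\in R^{\flat}\mid x^{(n)}\in J\text{ for all }n\ge 0\}$. Untilt of an ideal $I\subseteq R^{\flat}$ ($R$ perfectoid): $I^{\sharp}:=\theta_R(W(I))$, where $W(I):=\{\sum_{n\ge 0}[x_n]p^n\in W(R^{\flat})\mid x_n\in I\text{ for all }n\}$. *)

(* Defs.v *)
From HB Require Import structures.
From mathcomp Require Import all_boot all_order all_algebra.
From mathcomp Require Import finmap.
From mathcomp Require Import boolp classical_sets.
From mathcomp.multinomials Require Import monalg.

Set Implicit Arguments.
Unset Strict Implicit.
Unset Printing Implicit Defensive.

Import GRing.Theory.

Local Open Scope classical_set_scope.
Local Open Scope ring_scope.

Definition is_ideal (R : comPzRingType) (J : set R) : Prop :=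
  [/\ J 0, forall x y, J x -> J y -> J (x + y) & forall a x, J x -> J (a * x)].

Record ideal (R : comPzRingType) := Ideal {
  ideal_set :> R -> Prop;
  ideal_setP : is_ideal ideal_set }.

Section Ideals.
Variable R : comPzRingType.
Implicit Types (J : ideal R) (a x y z : R).

Lemma idl0 J : J 0. Proof. by case: J => J []. Qed.

Lemma idlD J x y : J x -> J y -> J (x + y).
Proof. by case: J => J [? h ?]; apply: h. Qed.

Lemma idlM J a x : J x -> J (a * x).
Proof. by case: J => J [? ? h]; apply: h. Qed.

Lemma idlN J x : J x -> J (- x).
Proof. by rewrite -mulN1r; exact: idlM. Qed.

Lemma idlB J x y : J x -> J y -> J (x - y).
Proof. by move=> Jx Jy; apply/idlD/idlN. Qed.

Lemma idl_sum J I r (P : pred I) (F : I -> R) :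
  (forall i, P i -> J (F i)) -> J (\sum_(i <- r | P i) F i).
Proof. by move=> h; elim/big_ind: _ => //; [exact: idl0|exact: idlD]. Qed.

Lemma is_pideal a : is_ideal [set x | exists c, x = a * c].
Proof.
split=> [|_ _ [c ->] [d ->]|b _ [c ->]]; first by exists 0; rewrite mulr0.
  by exists (c + d); rewrite mulrDr.
by exists (b * c); rewrite mulrCA.
Qed.

Definition pideal a : ideal R := Ideal (is_pideal a).

Definition eqmod a x y := pideal a (x - y).

Lemma eqmod_refl a x : eqmod a x x.
Proof. by rewrite /eqmod subrr; exact: idl0. Qed.

Lemma eqmod_sym a x y : eqmod a x y -> eqmod a y x.
Proof. by rewrite /eqmod -opprB => /idlN; rewrite opprK. Qed.

Lemma eqmod_trans a y x z : eqmod a x y -> eqmod a y z -> eqmod a x z.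
Proof. by move=> h k; have := idlD h k; rewrite addrA subrK. Qed.

Lemma eqmodD a x y x' y' :
  eqmod a x y -> eqmod a x' y' -> eqmod a (x + x') (y + y').
Proof. by move=> h k; rewrite /eqmod opprD addrACA; exact: idlD. Qed.

Lemma eqmodN a x y : eqmod a x y -> eqmod a (- x) (- y).
Proof. by move=> h; rewrite /eqmod -opprD; exact: idlN. Qed.

Lemma eqmodM a x y x' y' :
  eqmod a x y -> eqmod a x' y' -> eqmod a (x * x') (y * y').
Proof.
move=> h k; rewrite /eqmod; have -> : x * x' - y * y' = x' * (x - y) + y * (x' - y').
  by rewrite !mulrBr [x' * x]mulrC [x' * y]mulrC addrA subrK.
by apply: idlD; apply: idlM.
Qed.

Lemma eqmodX a x y n : eqmod a x y -> eqmod a (x ^+ n) (y ^+ n).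
Proof.
move=> h; elim: n => [|n IH]; first exact: eqmod_refl.
by rewrite !exprS; exact: eqmodM.
Qed.

Lemma eqmod_sum a I r (P : pred I) (F G : I -> R) :
  (forall i, P i -> eqmod a (F i) (G i)) ->
  eqmod a (\sum_(i <- r | P i) F i) (\sum_(i <- r | P i) G i).
Proof. by move=> h; rewrite /eqmod -sumrB; exact: idl_sum. Qed.

Lemma eqmod_mull a b x y : eqmod a x y -> eqmod (b * a) (b * x) (b * y).
Proof. by move=> [c h]; exists c; rewrite -mulrBr h mulrA. Qed.

Lemma eqmod_dvd a b x y : eqmod (a * b) x y -> eqmod a x y.
Proof. by move=> [c h]; exists (b * c); rewrite h mulrA. Qed.

Lemma eqmod_le a m n x y : (m <= n)%N -> eqmod (a ^+ n) x y -> eqmod (a ^+ m) x y.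
Proof. by move=> /subnKC <-; rewrite exprD; exact: eqmod_dvd. Qed.

End Ideals.

Section PrimePowers.
Variables (p : nat) (pr : prime p) (R : comPzRingType).
Implicit Types x y z : R.

Lemma frob_split y z : exists e, (y + z) ^+ p = y ^+ p + z ^+ p + p%:R * z * e.
Proof.
case: (p) (pr) => [//|q] prq; rewrite exprDn.
have h (i : 'I_q) : exists e,
    (y ^+ (q.+1 - i.+1) * z ^+ i.+1) *+ 'C(q.+1, i.+1) = q.+1%:R * z * e.
  have /dvdnP [k ->] : (q.+1 %| 'C(q.+1, i.+1))%N.
    by apply: prime_dvd_bin => //=; rewrite ltnS ltn_ord.
  exists (y ^+ (q.+1 - i.+1) * z ^+ i * k%:R).
  rewrite -mulr_natr natrM [z ^+ i.+1]exprS [y ^+ _ * (z * _)]mulrCA mulrA.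
  by rewrite [_ * q.+1%:R]mulrC -!mulrA.
have [e eE] := choice h.
exists (\sum_i e i).
rewrite big_ord_recl big_ord_recr /= /bump /= subn0 expr0 mulr1 bin0 mulr1n.
rewrite add1n subnn expr0 mul1r binn mulr1n mulr_sumr -addrA; congr (_ + _).
by rewrite addrC; congr (_ + _); apply: eq_bigr => i _; rewrite add1n; exact: eE.
Qed.

Lemma eqmod_frobD x y : eqmod p%:R ((x + y) ^+ p) (x ^+ p + y ^+ p).
Proof.
have [e ->] := frob_split x y; exists (y * e).
by rewrite mulrA addrC addKr.
Qed.

Lemma eqmod_expp k x y : (0 < k)%N ->
  eqmod (p%:R ^+ k) x y -> eqmod (p%:R ^+ k.+1) (x ^+ p) (y ^+ p).
Proof.
move=> k0 [c /eqP]; rewrite subr_eq addrC => /eqP ->.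
have [e ->] := frob_split y (p%:R ^+ k * c).
have [m mE] : exists m, (k * p = k.+1 + m)%N.
  exists (k * p - k.+1)%N; rewrite subnKC //.
  by apply: leq_trans (leq_mul (leqnn k) (prime_gt1 pr)); rewrite muln2 -addnn -addn1 leq_add2l.
exists (p%:R ^+ m * c ^+ p + c * e).
rewrite addrAC -addrA addrAC addrA subrr add0r addrC exprMn -exprM mE exprD mulrDr !mulrA.
by rewrite exprS.
Qed.

Lemma eqmod_exppX k j x y : (0 < k)%N ->
  eqmod (p%:R ^+ k) x y -> eqmod (p%:R ^+ (k + j)) (x ^+ (p ^ j)) (y ^+ (p ^ j)).
Proof.
move=> k0 h; elim: j => [|j IH]; first by rewrite addn0 expn0 !expr1.
rewrite addnS expnSr !exprM; apply: eqmod_expp => //; by rewrite addn_gt0 k0.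
Qed.

Lemma exp0p : (0 : R) ^+ p = 0.
Proof. by case: (p) pr => // n _; rewrite exprS mul0r. Qed.

Lemma eqmod_frob_sum I (r : seq I) (F G : I -> R) :
  (forall i, eqmod p%:R (F i) (G i ^+ p)) ->
  eqmod p%:R (\sum_(i <- r) F i) ((\sum_(i <- r) G i) ^+ p).
Proof.
move=> FG; apply: (big_rec2 (fun x y => eqmod p%:R x (y ^+ p))) => [|i y x _ h].
  by rewrite exp0p; exact: eqmod_refl.
by apply: eqmod_trans (eqmod_sym (eqmod_frobD _ _)); apply: eqmodD.
Qed.

Lemma eqmod_frob_int (x : R) (c : int) : eqmod p%:R (x ^+ p *~ c) ((x *~ c) ^+ p).
Proof.
have pos n : eqmod p%:R (n%:R : R) (n%:R ^+ p).
  elim: n => [|n IH]; first by rewrite exp0p; exact: eqmod_refl.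
  rewrite -natr1; apply: eqmod_trans (eqmod_sym (eqmod_frobD _ _)).
  by rewrite expr1n; apply: eqmodD => //; exact: eqmod_refl.
rewrite -mulrzr -[in X in eqmod _ _ X]mulrzr exprMn.
apply: eqmodM; first exact: eqmod_refl.
case: c => n; first exact: pos.
rewrite NegzE mulrNz -[_%:~R]/(n.+1%:R); set y : R := n.+1%:R.
apply: (eqmod_trans (eqmodN (pos n.+1))); rewrite -/y.
have := eqmod_frobD y (- y); rewrite subrr exp0p => /eqmod_sym.
by rewrite /eqmod subr0 => /idlN; rewrite opprD.
Qed.

End PrimePowers.

(* The polynomial ring over int in variables indexed by I, and its evaluation
   morphisms; mmap only targets nonzero rings. *)
Section IntegerPolynomials.
Variable I : choiceType.
Local Notation P := {malg int[{cmonom I}]}.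

Definition pvar (i : I) : P := << ucm i >>.

Definition mon_eval (A : comPzRingType) (f : I -> A) (m : {cmonom I}) : A :=
  \prod_(i <- finsupp m) f i ^+ m i.

Definition peval (A : comPzRingType) (f : I -> A) (g : P) : A :=
  \sum_(m <- msupp g) mon_eval f m *~ g@_m.

Section Eval.
Variables (A : comPzRingType) (f : I -> A).

Lemma mon_evalw (d : {fset I}) (m : {cmonom I}) : (finsupp m `<=` d)%fset ->
  mon_eval f m = \prod_(i <- d) f i ^+ m i.
Proof.
move=> le; apply: (big_fset_incl _ le) => i _.
by rewrite memNfinsupp => /eqP ->; rewrite expr0.
Qed.

Lemma mon_eval1 : mon_eval f mone = 1.
Proof. by rewrite /mon_eval mdom1 big_seq_fset0. Qed.

Lemma mon_evalM m1 m2 : mon_eval f (mmul m1 m2) = mon_eval f m1 * mon_eval f m2.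
Proof.
rewrite (mon_evalw (fsubsetUl (finsupp m1) (finsupp m2))).
rewrite (mon_evalw (fsubsetUr (finsupp m1) (finsupp m2))) -big_split /=.
by rewrite /mon_eval mdomD; apply: eq_bigr => i _; rewrite cmM exprD.
Qed.

Lemma mon_evalU i : mon_eval f (ucm i) = f i.
Proof. by rewrite /mon_eval mdomU big_seq_fset1 cmUU expr1. Qed.

Lemma pevalw (d : {fset {cmonom I}}) g : (msupp g `<=` d)%fset ->
  peval f g = \sum_(m <- d) mon_eval f m *~ g@_m.
Proof.
move=> le; rewrite /peval (big_fset_incl _ le) //= => m _ /mcoeff_outdom ->.
by rewrite mulr0z.
Qed.

Lemma pevalU c m : peval f << c *g m >> = mon_eval f m *~ c.
Proof. by rewrite (pevalw msuppU_le) big_seq_fset1 mcoeffUU. Qed.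

Lemma peval_is_zmod_morphism : zmod_morphism (peval f).
Proof.
move=> g h; set E := (msupp g `|` msupp h `|` msupp (g - h))%fset.
have [? ? ?] : [/\ msupp g `<=` E, msupp h `<=` E & msupp (g - h) `<=` E]%fset.
  by rewrite /E; split; [rewrite -fsetUA fsubsetUl | rewrite fsetUAC fsubsetUr
    | rewrite fsubsetUr].
rewrite 3?(pevalw (d := E)) // -sumrB; apply: eq_bigr => m _.
by rewrite mcoeffB mulrzBr.
Qed.

HB.instance Definition _ :=
  GRing.isZmodMorphism.Build P A (peval f) peval_is_zmod_morphism.

Lemma peval_is_monoid_morphism : monoid_morphism (peval f).
Proof.
split=> [|g1 g2]; first by rewrite pevalU mon_eval1.
rewrite malgME raddf_sum [in RHS]/peval mulr_suml /=; apply: eq_bigr=> i _.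
rewrite raddf_sum mulr_sumr /=; apply: eq_bigr=> j _.
by rewrite pevalU mon_evalM mulrzAr mulrzAl mulrzA.
Qed.

HB.instance Definition _ :=
  GRing.isMonoidMorphism.Build P A (peval f) peval_is_monoid_morphism.

Lemma peval_var i : peval f (pvar i) = f i.
Proof. by rewrite pevalU mon_evalU. Qed.

End Eval.

Lemma rmorph_peval (A B : comPzRingType) (h : {rmorphism A -> B}) (f : I -> A) g :
  h (peval f g) = peval (h \o f) g.
Proof.
rewrite /peval rmorph_sum; apply: eq_bigr => m _.
rewrite rmorphMz /mon_eval rmorph_prod; congr (_ *~ _).
by apply: eq_bigr => i _; rewrite rmorphXn.
Qed.

Lemma mon_eval_var m : mon_eval pvar m = << m >> :> P.
Proof.
have mM (x y : {cmonom I}) : << mmul x y >> = << x >> * << y >> :> P.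
  by rewrite malgM_def fgmulUU mulr1.
pose pw j n := iter n (mmul (ucm j)) (mone : {cmonom I}).
have pwE j n : pvar j ^+ n = << pw j n >>.
  by elim: n => [|n IH]; [rewrite expr0 -mpolyC1E | rewrite exprS IH /pw iterS mM].
have pwC j n i : pw j n i = ((j == i) * n)%N.
  by elim: n => [|n IH]; rewrite ?muln0 ?cm1 // mulnS -IH /pw iterS cmM cmU.
rewrite /mon_eval (eq_bigr _ (fun j _ => pwE j (m j))).
rewrite -(big_morph (fun x => << x >> : P) mM (esym (mpolyC1E _ _))); congr << _ >>.
apply/eqP/cmP => i.
rewrite (big_morph (fun x : {cmonom I} => x i) (fun x y => cmM i x y) (cm1 i)).
rewrite (eq_bigr _ (fun j _ => pwC j (m j) i)).
case: (boolP (i \in finsupp m)) => [im|]; last first.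
  rewrite memNfinsupp => /eqP h; rewrite h big1 // => j _.
  by case: eqP => // ->; rewrite h.
rewrite (big_fsetD1 i) //= eqxx mul1n big_seq big1 ?addn0 // => j.
by rewrite !inE => /andP[/negPf ->].
Qed.

Lemma peval_id g : peval pvar g = g.
Proof.
rewrite [RHS]monalgE; apply: eq_bigr => m _.
by rewrite mon_eval_var -raddfMz /= intz.
Qed.

Lemma poly_torsion_free (p : nat) (g : P) : (0 < p)%N -> p%:R * g = 0 -> g = 0.
Proof.
move=> p0; rewrite mulr_natl => h; apply/malgP => m; rewrite mcoeff0.
have /eqP := congr1 (mcoeff m) h; rewrite mcoeffMn mcoeff0 Num.Theory.mulrn_eq0.
by rewrite eqn0Ngt p0 => /eqP.
Qed.

Section FrobeniusLift.
Variables (p : nat) (pr : prime p).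

Definition frob_lift : P -> P := peval (fun i => pvar i ^+ p).

Lemma eqmod_frob_lift g : eqmod p%:R (frob_lift g) (g ^+ p).
Proof.
rewrite -{2}[g](peval_id g); apply: eqmod_frob_sum => // m.
have -> : mon_eval (fun i => pvar i ^+ p) m = mon_eval pvar m ^+ p.
  by rewrite /mon_eval -prodrXl; apply: eq_bigr => i _; rewrite exprAC.
exact: eqmod_frob_int.
Qed.

End FrobeniusLift.
End IntegerPolynomials.

Section Ghost.
Variable p : nat.

Definition ghost (A : comPzRingType) (a : nat -> A) (n : nat) : A :=
  \sum_(i < n.+1) p%:R ^+ i * a i ^+ (p ^ (n - i)).

Lemma ghostS (A : comPzRingType) (a : nat -> A) n :
  ghost a n = \sum_(i < n) p%:R ^+ i * a i ^+ (p ^ (n - i)) + p%:R ^+ n * a n.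
Proof. by rewrite /ghost big_ord_recr /= subnn expn0 expr1. Qed.

Lemma rmorph_ghost (A B : comPzRingType) (h : {rmorphism A -> B}) (a : nat -> A) n :
  h (ghost a n) = ghost (h \o a) n.
Proof.
rewrite /ghost rmorph_sum; apply: eq_bigr => i _.
by rewrite rmorphM !rmorphXn rmorph_nat.
Qed.

Lemma eq_ghost (A : comPzRingType) (a b : nat -> A) n :
  (forall i, (i <= n)%N -> a i = b i) -> ghost a n = ghost b n.
Proof.
by move=> ab; apply: eq_bigr => i _; rewrite ab // -ltnS.
Qed.

Section TorsionFree.
Hypothesis pr : prime p.
Variables (B : comPzRingType) (phi : {rmorphism B -> B}).
Hypothesis tf : forall x : B, p%:R * x = 0 -> x = 0.
Hypothesis phiP : forall x : B, eqmod p%:R (phi x) (x ^+ p).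

Lemma tfX n (x : B) : p%:R ^+ n * x = 0 -> x = 0.
Proof. by elim: n => [|n IH]; rewrite ?mul1r // exprS -mulrA => /tf. Qed.

Lemma tf_eqmod n (x y : B) :
  eqmod (p%:R ^+ n.+1) (p%:R ^+ n * x) (p%:R ^+ n * y) -> eqmod p%:R x y.
Proof.
move=> [c]; rewrite -mulrBr exprSr -mulrA => /eqP; rewrite -subr_eq0 -mulrBr.
by move=> /eqP /tfX /eqP; rewrite subr_eq0 => /eqP h; exists c.
Qed.

Lemma ghost_inj_le (a b : nat -> B) n :
  (forall i, (i <= n)%N -> ghost a i = ghost b i) ->
  forall i, (i <= n)%N -> a i = b i.
Proof.
move=> ab i; elim/ltn_ind: i => i IH ilen.
have := ab i ilen; rewrite !ghostS.
rewrite (eq_bigr (fun j : 'I_i => p%:R ^+ j * b j ^+ (p ^ (i - j)))) => [|j _].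
  by move/addrI/eqP; rewrite -subr_eq0 -mulrBr => /eqP/tfX/eqP; rewrite subr_eq0 => /eqP.
by rewrite IH // (leq_trans _ ilen) // ltnW.
Qed.

Lemma ghost_inj (a b : nat -> B) : (forall n, ghost a n = ghost b n) -> a = b.
Proof. by move=> ab; apply/funext => n; apply: (@ghost_inj_le a b n). Qed.

Lemma ghost_eqmod (a b : nat -> B) :
  (forall n, eqmod (p%:R ^+ n.+1) (ghost a n) (ghost b n)) ->
  forall n, eqmod p%:R (a n) (b n).
Proof.
move=> ab n; elim/ltn_ind: n => n IH; apply: (@tf_eqmod n).
have h : eqmod (p%:R ^+ n.+1) (\sum_(i < n) p%:R ^+ i * a i ^+ (p ^ (n - i)))
                              (\sum_(i < n) p%:R ^+ i * b i ^+ (p ^ (n - i)) : B).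
  apply: eqmod_sum => i _.
  have -> : n.+1 = (i + (1 + (n - i)))%N by rewrite add1n addnS subnKC // ltnW.
  rewrite exprD; apply: eqmod_mull; apply: (eqmod_exppX pr) => //.
  by rewrite expr1; exact: IH.
have e (c : nat -> B) : p%:R ^+ n * c n =
    ghost c n - \sum_(i < n) p%:R ^+ i * c i ^+ (p ^ (n - i)).
  by rewrite ghostS addrAC subrr add0r.
by rewrite !e; exact: eqmodD (ab n) (eqmodN h).
Qed.

Lemma ghost_frob (a : nat -> B) n :
  eqmod (p%:R ^+ n.+1) (phi (ghost a n)) (\sum_(i < n.+1) p%:R ^+ i * a i ^+ (p ^ (n.+1 - i))).
Proof.
rewrite /ghost rmorph_sum; apply: eqmod_sum => i _.
rewrite rmorphM !rmorphXn rmorph_nat.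
have -> : p%:R ^+ n.+1 = p%:R ^+ i * p%:R ^+ (1 + (n - i)) :> B.
  by rewrite -exprD add1n addnS subnKC // -ltnS.
apply: eqmod_mull; rewrite subSn -1?ltnS // expnS exprM.
by apply: (eqmod_exppX pr) => //; rewrite expr1.
Qed.

Lemma ghost_phi (a : nat -> B) n :
  eqmod (p%:R ^+ n.+1) (phi (ghost a n)) (ghost a n.+1).
Proof.
apply: eqmod_trans (ghost_frob a n) _; rewrite ghostS; apply: eqmod_sym.
by exists (a n.+1); rewrite addrAC subrr add0r.
Qed.

Lemma ghost_surj (u : nat -> B) :
  (forall n, eqmod (p%:R ^+ n.+1) (phi (u n)) (u n.+1)) ->
  exists a, forall n, ghost a n = u n.
Proof.
move=> uP.
have step n : exists a, forall i, (i <= n)%N -> ghost a i = u i.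
  elim: n => [|n [a aP]].
    exists u => i; rewrite leqn0 => /eqP ->.
    by rewrite ghostS big_ord0 add0r mul1r.
  have [c cE] : eqmod (p%:R ^+ n.+1) (u n.+1)
                  (\sum_(i < n.+1) p%:R ^+ i * a i ^+ (p ^ (n.+1 - i))).
    by apply: eqmod_trans (eqmod_sym (uP n)) _; rewrite -aP //; exact: ghost_frob.
  exists (fun i => if i == n.+1 then c else a i) => i.
  rewrite leq_eqVlt => /orP[/eqP ->|ilt]; last first.
    rewrite -(aP i) //; apply: eq_ghost => j ji.
    by rewrite ltn_eqF // (leq_ltn_trans ji).
  rewrite ghostS eqxx -cE (eq_bigr (fun j : 'I__ => p%:R ^+ j * a j ^+ (p ^ (n.+1 - j)))).
    by rewrite addrC subrK.
  by move=> j _; rewrite ltn_eqF.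
have [a aP] := choice step.
exists (fun n => a n n) => n; rewrite -(aP n n) //; apply: eq_ghost => i ilen.
apply: (@ghost_inj_le _ _ i) => // j ji; rewrite !aP //; exact: leq_trans ilen.
Qed.

End TorsionFree.
End Ghost.

Section WittPolynomials.
Variable p : nat.

(* Integer polynomials with prescribed ghost components: the solution is unique
   because the polynomial ring is torsion free, and unghostP gives existence. *)
Definition unghost (I : choiceType) (u : nat -> {malg int[{cmonom I}]}) :
    nat -> {malg int[{cmonom I}]} :=
  xget (fun=> 0) [set a | forall n, ghost p a n = u n].

Local Notation X := (fun n : nat => pvar (false, n)).
Local Notation Y := (fun n : nat => pvar (true, n)).

Definition witt_addp := unghost (fun n => ghost p X n + ghost p Y n).
Definition witt_oppp := unghost (fun n => - ghost p X n).
Definition witt_mulp := unghost (fun n => ghost p X n * ghost p Y n).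

Section Existence.
Hypothesis pr : prime p.
Variable I : choiceType.
Local Notation P := {malg int[{cmonom I}]}.

Definition frob_lift_rmorph : {rmorphism P -> P} := peval (fun i : I => pvar i ^+ p).

Lemma poly_tf (x : P) : p%:R * x = 0 -> x = 0.
Proof. exact/poly_torsion_free/prime_gt0. Qed.

Lemma poly_frob (x : P) : eqmod p%:R (frob_lift_rmorph x) (x ^+ p).
Proof. exact: eqmod_frob_lift. Qed.

Lemma unghostP (u : nat -> P) :
  (forall n, eqmod (p%:R ^+ n.+1) (frob_lift_rmorph (u n)) (u n.+1)) ->
  forall n, ghost p (unghost u) n = u n.
Proof.
by move=> /(ghost_surj pr poly_tf poly_frob) h; exact: (xgetPex (fun=> 0) h).
Qed.

End Existence.

Lemma ghost_witt_addp : prime p ->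
  forall n, ghost p witt_addp n = ghost p X n + ghost p Y n.
Proof.
move=> pr; apply: (unghostP pr) => n; rewrite rmorphD.
by apply: eqmodD; apply: (ghost_phi pr); exact: poly_frob.
Qed.

Lemma ghost_witt_oppp : prime p -> forall n, ghost p witt_oppp n = - ghost p X n.
Proof.
move=> pr; apply: (unghostP pr) => n; rewrite rmorphN.
by apply: eqmodN; apply: (ghost_phi pr); exact: poly_frob.
Qed.

Lemma ghost_witt_mulp : prime p ->
  forall n, ghost p witt_mulp n = ghost p X n * ghost p Y n.
Proof.
move=> pr; apply: (unghostP pr) => n; rewrite rmorphM.
by apply: eqmodM; apply: (ghost_phi pr); exact: poly_frob.
Qed.

End WittPolynomials.

Section WittOperations.
Variables (p : nat) (pr : prime p).

Definition witt_vars (A : comPzRingType) (a b : nat -> A) (i : bool * nat) : A :=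
  if i.1 then b i.2 else a i.2.

Section Ops.
Variable A : comPzRingType.
Implicit Types a b c : nat -> A.

Definition wadd a b n := peval (witt_vars a b) (witt_addp p n).
Definition wmul a b n := peval (witt_vars a b) (witt_mulp p n).
Definition wopp a n := peval (witt_vars a a) (witt_oppp p n).
Definition wteich (x : A) n : A := if n is 0 then x else 0.
Definition wzero (n : nat) : A := 0.

Lemma ghost_wadd a b n : ghost p (wadd a b) n = ghost p a n + ghost p b n.
Proof.
transitivity (peval (witt_vars a b) (ghost p (witt_addp p) n)); first by rewrite rmorph_ghost.
rewrite (ghost_witt_addp pr) rmorphD; congr (_ + _);
  by rewrite rmorph_ghost; apply: eq_ghost => i _ /=; rewrite peval_var.
Qed.

Lemma ghost_wmul a b n : ghost p (wmul a b) n = ghost p a n * ghost p b n.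
Proof.
transitivity (peval (witt_vars a b) (ghost p (witt_mulp p) n)); first by rewrite rmorph_ghost.
rewrite (ghost_witt_mulp pr) rmorphM; congr (_ * _);
  by rewrite rmorph_ghost; apply: eq_ghost => i _ /=; rewrite peval_var.
Qed.

Lemma ghost_wopp a n : ghost p (wopp a) n = - ghost p a n.
Proof.
transitivity (peval (witt_vars a a) (ghost p (witt_oppp p) n)); first by rewrite rmorph_ghost.
rewrite (ghost_witt_oppp pr) rmorphN; congr (- _);
  by rewrite rmorph_ghost; apply: eq_ghost => i _ /=; rewrite peval_var.
Qed.

Lemma ghost_wteich x n : ghost p (wteich x) n = x ^+ (p ^ n).
Proof.
rewrite /ghost big_ord_recl subn0 mul1r big1 ?addr0 // => i _.
have : (0 < p ^ (n - lift ord0 i))%N by rewrite expn_gt0 prime_gt0.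
by case: (p ^ _)%N => // k _; rewrite /= exprS mul0r mulr0.
Qed.

Lemma ghost_wzero n : ghost p wzero n = 0.
Proof.
rewrite (@eq_ghost p A _ (wteich 0)) ?ghost_wteich => [|[]//].
have : (0 < p ^ n)%N by rewrite expn_gt0 prime_gt0.
by case: (p ^ _)%N => // k _; rewrite exprS mul0r.
Qed.

End Ops.

Section Naturality.
Variables (A B : comPzRingType) (h : {rmorphism A -> B}).
Implicit Types a b : nat -> A.

Lemma comp_witt_vars a b : h \o witt_vars a b = witt_vars (h \o a) (h \o b).
Proof. by apply/funext => -[[] n]. Qed.

Lemma comp_wadd a b : h \o wadd a b = wadd (h \o a) (h \o b).
Proof. by apply/funext => n; rewrite /= rmorph_peval comp_witt_vars. Qed.

Lemma comp_wmul a b : h \o wmul a b = wmul (h \o a) (h \o b).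
Proof. by apply/funext => n; rewrite /= rmorph_peval comp_witt_vars. Qed.

Lemma comp_wopp a : h \o wopp a = wopp (h \o a).
Proof. by apply/funext => n; rewrite /= rmorph_peval comp_witt_vars. Qed.

Lemma comp_wteich x : h \o wteich x = wteich (h x).
Proof. by apply/funext => -[|n] //=; rewrite rmorph0. Qed.

Lemma comp_wzero : h \o @wzero A = @wzero B.
Proof. by apply/funext => n; rewrite /= rmorph0. Qed.

End Naturality.

Section Laws.
Variable A : comPzRingType.
Implicit Types a b c : nat -> A.

Local Notation P := {malg int[{cmonom A}]}.

Definition peps : {rmorphism P -> A} := peval id.
Definition wup a : nat -> P := fun n => pvar (a n).

(* a lifts to a vector over P with ghost components g *)
Definition wlift (g : nat -> P) a :=
  exists2 u : nat -> P, peps \o u = a & forall n, ghost p u n = g n.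

Lemma wlift_up a : wlift (ghost p (wup a)) a.
Proof. by exists (wup a) => //; apply/funext => n; rewrite /= peval_var. Qed.

Lemma wliftD g h a b : wlift g a -> wlift h b -> wlift (fun n => g n + h n) (wadd a b).
Proof.
move=> [u <- ug] [v <- vh]; exists (wadd u v); first exact: comp_wadd.
by move=> n; rewrite ghost_wadd ug vh.
Qed.

Lemma wliftM g h a b : wlift g a -> wlift h b -> wlift (fun n => g n * h n) (wmul a b).
Proof.
move=> [u <- ug] [v <- vh]; exists (wmul u v); first exact: comp_wmul.
by move=> n; rewrite ghost_wmul ug vh.
Qed.

Lemma wliftN g a : wlift g a -> wlift (fun n => - g n) (wopp a).
Proof.
move=> [u <- ug]; exists (wopp u); first exact: comp_wopp.
by move=> n; rewrite ghost_wopp ug.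
Qed.

Lemma wlift0 : wlift (fun=> 0) (@wzero A).
Proof. by exists (@wzero P); [exact: comp_wzero | exact: ghost_wzero]. Qed.

Lemma wlift_teich (x : P) : wlift (fun n => x ^+ (p ^ n)) (wteich (peps x)).
Proof. by exists (wteich x); [exact: comp_wteich | exact: ghost_wteich]. Qed.

Lemma wlift1 : wlift (fun=> 1) (wteich (1 : A)).
Proof.
have [u uE ug] := wlift_teich 1; exists u; first by rewrite uE rmorph1.
by move=> n; rewrite ug expr1n.
Qed.

Lemma wlift_eq g h a b : wlift g a -> wlift h b -> (forall n, g n = h n) -> a = b.
Proof.
move=> [u <- ug] [v <- vh] gh; suff -> : u = v by [].
apply: (@ghost_inj p P (@poly_tf p pr A)) => n; by rewrite ug vh.
Qed.

Local Notation up := wlift_up.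

Lemma waddA : associative (@wadd A).
Proof.
move=> a b c; apply: (wlift_eq (wliftD (up a) (wliftD (up b) (up c)))
                               (wliftD (wliftD (up a) (up b)) (up c))) => n.
exact: addrA.
Qed.

Lemma waddC : commutative (@wadd A).
Proof.
move=> a b; apply: (wlift_eq (wliftD (up a) (up b)) (wliftD (up b) (up a))) => n.
exact: addrC.
Qed.

Lemma wadd0 : left_id (@wzero A) (@wadd A).
Proof. by move=> a; apply: (wlift_eq (wliftD wlift0 (up a)) (up a)) => n; exact: add0r. Qed.

Lemma waddN : left_inverse (@wzero A) (@wopp A) (@wadd A).
Proof.
by move=> a; apply: (wlift_eq (wliftD (wliftN (up a)) (up a)) wlift0) => n; exact: addNr.
Qed.

Lemma wmulA : associative (@wmul A).
Proof.
move=> a b c; apply: (wlift_eq (wliftM (up a) (wliftM (up b) (up c)))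
                               (wliftM (wliftM (up a) (up b)) (up c))) => n.
exact: mulrA.
Qed.

Lemma wmulC : commutative (@wmul A).
Proof.
move=> a b; apply: (wlift_eq (wliftM (up a) (up b)) (wliftM (up b) (up a))) => n.
exact: mulrC.
Qed.

Lemma wmul1 : left_id (wteich (1 : A)) (@wmul A).
Proof. by move=> a; apply: (wlift_eq (wliftM wlift1 (up a)) (up a)) => n; exact: mul1r. Qed.

Lemma wmulDl : left_distributive (@wmul A) (@wadd A).
Proof.
move=> a b c; apply: (wlift_eq (wliftM (wliftD (up a) (up b)) (up c))
  (wliftD (wliftM (up a) (up c)) (wliftM (up b) (up c)))) => n.
exact: mulrDl.
Qed.

Definition wtail a n : A := if n is m.+1 then a m.+1 else 0.

Lemma wlift_tail a : wlift (fun n => ghost p (wup a) n - wup a 0%N ^+ (p ^ n)) (wtail a).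
Proof.
exists (fun n => if n is m.+1 then wup a m.+1 else 0) => [|n].
  by apply/funext => -[|n] /=; rewrite ?rmorph0 ?peval_var.
rewrite /ghost [in RHS]big_ord_recl subn0 mul1r addrAC subrr add0r big_ord_recl.
rewrite [X in X + _](_ : _ = 0) ?add0r // subn0.
have : (0 < p ^ n)%N by rewrite expn_gt0 prime_gt0.
by case: (p ^ n)%N => // k _; rewrite exprS mul0r mulr0.
Qed.

Lemma wadd_split a : a = wadd (wteich (a 0%N)) (wtail a).
Proof.
have ht := wlift_teich (wup a 0%N).
rewrite /peps /wup /= peval_var in ht.
apply: (wlift_eq (up a) (wliftD ht (wlift_tail a))) => n.
by rewrite addrC subrK.
Qed.

(* p * (a_0, a_1, ...) = (0, a_0 ^ p, a_1 ^ p, ...) in characteristic p *)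
Definition wVF a n : A := if n is m.+1 then a m ^+ p else 0.

Lemma wlift_congr g h a b : p%:R = 0 :> A -> wlift g a -> wlift h b ->
  (forall n, eqmod (p%:R ^+ n.+1) (g n) (h n)) -> a = b.
Proof.
move=> p0 [u <- ug] [v <- vh] gh.
have uv : forall n, eqmod p%:R (u n) (v n).
  apply: (@ghost_eqmod p pr P (@poly_tf p pr A)) => n; by rewrite ug vh.
apply/funext => n; have [c /(congr1 peps)] := uv n.
rewrite rmorphB rmorphM rmorph_nat p0 mul0r => /eqP.
by rewrite subr_eq0 => /eqP.
Qed.

Lemma wlift_VF a : exists2 g, wlift g (wVF a) &
  forall n, eqmod (p%:R ^+ n.+1) (p%:R * ghost p (wup a) n) (g n).
Proof.
pose v n : P := if n is m.+1 then wup a m ^+ p else 0.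
exists (ghost p v).
  exists v => //; apply/funext => -[|n] /=; first by rewrite rmorph0.
  by rewrite rmorphXn /= peval_var.
have v0 n : ghost p v n = \sum_(i < n) p%:R * (p%:R ^+ i * wup a i ^+ (p ^ (n - i))).
  rewrite /ghost big_ord_recl [X in X + _](_ : _ = 0) ?add0r; last first.
    rewrite subn0; have : (0 < p ^ n)%N by rewrite expn_gt0 prime_gt0.
    by rewrite /v /=; case: (p ^ n)%N => // k _; rewrite exprS mul0r mulr0.
  apply: eq_bigr => i _; rewrite lift0 exprS -!mulrA -[v i.+1]/(wup a i ^+ p).
  by rewrite -exprM -expnS -subSn ?subSS.
move=> n; rewrite v0 -mulr_sumr ghostS mulrDr mulrA -exprS.
by exists (wup a n); rewrite addrAC subrr add0r.
Qed.

End Laws.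
End WittOperations.

(* p-typical Witt vectors, in Witt coordinates; pr only serves to attach the ring
   structure *)
Record witt (p : nat) (pr : prime p) (A : comPzRingType) := Witt { wcoord : nat -> A }.

Section WittRing.
Variables (p : nat) (pr : prime p) (A : comPzRingType).
Local Notation W := (witt pr A).
Implicit Types u v w : W.

HB.instance Definition _ := gen_eqMixin W.
HB.instance Definition _ := gen_choiceMixin W.

Lemma wcoord_inj : injective (@wcoord p pr A).
Proof. by case=> a [b] /= ->. Qed.

Definition witt0 : W := Witt pr (@wzero A).
Definition witt1 : W := Witt pr (wteich 1).
Definition witt_add u v : W := Witt pr (wadd p (wcoord u) (wcoord v)).
Definition witt_opp u : W := Witt pr (wopp p (wcoord u)).
Definition witt_mul u v : W := Witt pr (wmul p (wcoord u) (wcoord v)).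

Lemma witt_addA : associative witt_add.
Proof. by move=> u v w; apply: wcoord_inj; exact: waddA. Qed.
Lemma witt_addC : commutative witt_add.
Proof. by move=> u v; apply: wcoord_inj; exact: waddC. Qed.
Lemma witt_add0 : left_id witt0 witt_add.
Proof. by move=> u; apply: wcoord_inj; exact: wadd0. Qed.
Lemma witt_addN : left_inverse witt0 witt_opp witt_add.
Proof. by move=> u; apply: wcoord_inj; exact: waddN. Qed.
Lemma witt_mulA : associative witt_mul.
Proof. by move=> u v w; apply: wcoord_inj; exact: wmulA. Qed.
Lemma witt_mulC : commutative witt_mul.
Proof. by move=> u v; apply: wcoord_inj; exact: wmulC. Qed.
Lemma witt_mul1 : left_id witt1 witt_mul.
Proof. by move=> u; apply: wcoord_inj; exact: wmul1. Qed.
Lemma witt_mulDl : left_distributive witt_mul witt_add.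
Proof. by move=> u v w; apply: wcoord_inj; exact: wmulDl. Qed.

HB.instance Definition _ :=
  GRing.isZmodule.Build W witt_addA witt_addC witt_add0 witt_addN.
HB.instance Definition _ :=
  GRing.Zmodule_isComPzRing.Build W witt_mulA witt_mulC witt_mul1 witt_mulDl.

Definition teich (x : A) : W := Witt pr (wteich x).

(* the sum of the [x_n] p^n when p = 0 in A, see teich_series_sum *)
Definition teich_series (x : nat -> A) : W := Witt pr (fun n => x n ^+ (p ^ n)).

Lemma wlift_natmul g w k :
  wlift p g (wcoord w) -> wlift p (fun n => k%:R * g n) (wcoord (k%:R * w)).
Proof.
move=> h; elim: k => [|k IH].
  have [u uE ug] := wlift0 pr A.
  by rewrite mul0r; exists u => // n; rewrite ug mul0r.
have [u uE ug] := wliftD pr h IH.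
have -> : k.+1%:R * w = w + k%:R * w by rewrite mulrS mulrDl mul1r.
by exists u => // n; rewrite ug mulrS mulrDl mul1r.
Qed.

Hypothesis charA : p%:R = 0 :> A.

Lemma wcoord_pM w : wcoord (p%:R * w) = wVF p (wcoord w).
Proof.
have [g gl gE] := wlift_VF pr (wcoord w).
exact: (wlift_congr pr charA (wlift_natmul p (wlift_up p (wcoord w))) gl gE).
Qed.

Lemma teich_seriesS (x : nat -> A) :
  teich_series x = teich (x 0%N) + p%:R * teich_series (fun n => x n.+1).
Proof.
apply: wcoord_inj; rewrite [LHS](wadd_split pr).
rewrite -[RHS]/(wadd p (wteich (x 0%N)) (wcoord (p%:R * teich_series (fun n => x n.+1)))).
rewrite wcoord_pM; congr wadd.
by apply/funext => -[|n] //=; rewrite -exprM expnSr.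
Qed.

Lemma teich_series_sum (x : nat -> A) N :
  teich_series x = \sum_(n < N) teich (x n) * p%:R ^+ n
                   + teich_series (fun n => x (N + n)%N) * p%:R ^+ N.
Proof.
elim: N => [|N IH].
  by rewrite big_ord0 add0r mulr1; congr teich_series.
rewrite {}IH big_ord_recr /= -addrA; congr (_ + _).
rewrite [in LHS]teich_seriesS addn0 mulrDl; congr (_ + _).
rewrite mulrAC [RHS]mulrC -exprS; congr (_ * _).
by congr teich_series; apply/funext => n; rewrite addnS.
Qed.

End WittRing.

Section QuotientRing.
Variables (R : comPzRingType) (J : ideal R).

Definition mem_ideal : {pred R} := fun x => `[< J x >].

Lemma mem_idealE x : (x \in mem_ideal) = `[< J x >]. Proof. by []. Qed.

Lemma mem_ideal_zmod_closed : zmod_closed mem_ideal.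
Proof.
split=> [|x y]; rewrite !mem_idealE; first exact/asboolP/idl0.
by move=> /asboolP Jx /asboolP Jy; apply/asboolP; exact: idlB.
Qed.

HB.instance Definition _ := GRing.isZmodClosed.Build R mem_ideal mem_ideal_zmod_closed.

(* ring_quotient only makes the quotient a ring when the ideal is proper *)
Definition rquot : Type := Quotient.quot mem_ideal.

HB.instance Definition _ := GRing.Zmodule.on rquot.

Definition rproj : R -> rquot := \pi_(Quotient.quot mem_ideal)%qT.

Lemma rproj_eq x y : rproj x = rproj y <-> J (x - y).
Proof.
split=> [/eqP|h]; first by rewrite -Quotient.idealrBE => /asboolP.
by apply/eqP; rewrite -Quotient.idealrBE; exact/asboolP.
Qed.

Definition rrepr (x : rquot) : R := repr (x : Quotient.quot mem_ideal).

Lemma rreprK : cancel rrepr rproj.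
Proof. by move=> x; exact: reprK. Qed.

Lemma rproj_is_zmod_morphism : zmod_morphism rproj.
Proof. by move=> x y; rewrite /rproj !piE. Qed.

HB.instance Definition _ :=
  GRing.isZmodMorphism.Build R rquot rproj rproj_is_zmod_morphism.

Definition rquot_one : rquot := rproj 1.
Definition rquot_mul (x y : rquot) : rquot := rproj (rrepr x * rrepr y).

Lemma rproj_mul x y : rproj (x * y) = rquot_mul (rproj x) (rproj y).
Proof.
apply/rproj_eq.
have Jr z : J (z - rrepr (rproj z)) by apply/rproj_eq; rewrite rreprK.
set x' := rrepr _; set y' := rrepr _.
have -> : x * y - x' * y' = y * (x - x') + x' * (y - y').
  by rewrite !mulrBr [y * x]mulrC [y * x']mulrC addrA subrK.
by apply: idlD; apply: idlM; exact: Jr.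
Qed.

Lemma rquot_mulA : associative rquot_mul.
Proof.
move=> x y z; rewrite -(rreprK x) -(rreprK y) -(rreprK z).
by rewrite -!rproj_mul mulrA.
Qed.

Lemma rquot_mulC : commutative rquot_mul.
Proof. by move=> x y; rewrite /rquot_mul mulrC. Qed.

Lemma rquot_mul1 : left_id rquot_one rquot_mul.
Proof. by move=> x; rewrite -(rreprK x) -rproj_mul mul1r. Qed.

Lemma rquot_mulDl : left_distributive rquot_mul +%R.
Proof.
move=> x y z; rewrite -(rreprK x) -(rreprK y) -(rreprK z).
by rewrite -raddfD -!rproj_mul -raddfD mulrDl.
Qed.

HB.instance Definition _ := GRing.Zmodule_isComPzRing.Build rquot
  rquot_mulA rquot_mulC rquot_mul1 rquot_mulDl.

Lemma rproj_is_monoid_morphism : monoid_morphism rproj.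
Proof. by split=> [//|x y]; exact: rproj_mul. Qed.

HB.instance Definition _ :=
  GRing.isMonoidMorphism.Build R rquot rproj rproj_is_monoid_morphism.

End QuotientRing.


Lemma rquot_p0 (R : comPzRingType) (a : R) : rproj (pideal a) a = 0.
Proof. by rewrite -(rmorph0 (rproj (pideal a))); apply/rproj_eq; exists 1; rewrite mulr1 subr0. Qed.

(* the inverse limit of R/pR along Frobenius *)
Record tilt (p : nat) (pr : prime p) (R : comPzRingType) := Tilt {
  tcoord : nat -> rquot (pideal (p%:R : R));
  tcoordP : forall n, tcoord n.+1 ^+ p = tcoord n }.

Section TiltRing.
Variables (p : nat) (pr : prime p) (R : comPzRingType).
Local Notation Rp := (rquot (pideal (p%:R : R))).
Local Notation T := (tilt pr R).
Implicit Types x y z : T.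

HB.instance Definition _ := gen_eqMixin T.
HB.instance Definition _ := gen_choiceMixin T.

Lemma tilt_eq x y : (forall n, tcoord x n = tcoord y n) -> x = y.
Proof.
case: x y => [x xP] [y yP] /= /funext xy; case: y / xy in yP *.
by congr Tilt; exact: Prop_irrelevance.
Qed.

Lemma charRp : p%:R = 0 :> Rp.
Proof. by have := rquot_p0 (p%:R : R); rewrite rmorph_nat. Qed.

Lemma frobRpD (x y : Rp) : (x + y) ^+ p = x ^+ p + y ^+ p.
Proof.
have [c /eqP] := eqmod_frobD pr x y.
by rewrite charRp mul0r subr_eq0 => /eqP.
Qed.

Lemma tilt_add_subproof x y n :
  (tcoord x n.+1 + tcoord y n.+1) ^+ p = tcoord x n + tcoord y n.
Proof. by rewrite frobRpD !tcoordP. Qed.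

Lemma tilt_zero_subproof (n : nat) : (0 : Rp) ^+ p = 0.
Proof. exact: exp0p. Qed.

Lemma tilt_opp_subproof x n : (- tcoord x n.+1) ^+ p = - tcoord x n.
Proof.
apply/eqP; rewrite -subr_eq0 opprK -(tcoordP x n) -frobRpD.
by rewrite addNr exp0p.
Qed.

Lemma tilt_mul_subproof x y n :
  (tcoord x n.+1 * tcoord y n.+1) ^+ p = tcoord x n * tcoord y n.
Proof. by rewrite exprMn !tcoordP. Qed.

Lemma tilt_one_subproof (n : nat) : (1 : Rp) ^+ p = 1.
Proof. exact: expr1n. Qed.

Definition tilt_zero : T := Tilt pr tilt_zero_subproof.
Definition tilt_one : T := Tilt pr tilt_one_subproof.
Definition tilt_add x y : T := Tilt pr (tilt_add_subproof x y).
Definition tilt_opp x : T := Tilt pr (tilt_opp_subproof x).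
Definition tilt_mul x y : T := Tilt pr (tilt_mul_subproof x y).

Lemma tilt_addA : associative tilt_add.
Proof. by move=> x y z; apply: tilt_eq => n; exact: addrA. Qed.
Lemma tilt_addC : commutative tilt_add.
Proof. by move=> x y; apply: tilt_eq => n; exact: addrC. Qed.
Lemma tilt_add0 : left_id tilt_zero tilt_add.
Proof. by move=> x; apply: tilt_eq => n; exact: add0r. Qed.
Lemma tilt_addN : left_inverse tilt_zero tilt_opp tilt_add.
Proof. by move=> x; apply: tilt_eq => n; exact: addNr. Qed.
Lemma tilt_mulA : associative tilt_mul.
Proof. by move=> x y z; apply: tilt_eq => n; exact: mulrA. Qed.
Lemma tilt_mulC : commutative tilt_mul.
Proof. by move=> x y; apply: tilt_eq => n; exact: mulrC. Qed.
Lemma tilt_mul1 : left_id tilt_one tilt_mul.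
Proof. by move=> x; apply: tilt_eq => n; exact: mul1r. Qed.
Lemma tilt_mulDl : left_distributive tilt_mul tilt_add.
Proof. by move=> x y z; apply: tilt_eq => n; exact: mulrDl. Qed.

HB.instance Definition _ :=
  GRing.isZmodule.Build T tilt_addA tilt_addC tilt_add0 tilt_addN.
HB.instance Definition _ :=
  GRing.Zmodule_isComPzRing.Build T tilt_mulA tilt_mulC tilt_mul1 tilt_mulDl.

Lemma tcoordD x y n : tcoord (x + y) n = tcoord x n + tcoord y n.
Proof. by []. Qed.

Lemma tcoordM x y n : tcoord (x * y) n = tcoord x n * tcoord y n.
Proof. by []. Qed.

Lemma tcoordX x k n : tcoord (x ^+ k) n = tcoord x n ^+ k.
Proof. by elim: k => [//|k IH]; rewrite !exprS tcoordM IH. Qed.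

Lemma charT : p%:R = 0 :> T.
Proof.
apply: tilt_eq => n; have -> k : tcoord (k%:R : T) n = k%:R; last exact: charRp.
by elim: k => [//|k IH]; rewrite !mulrS tcoordD IH.
Qed.

Lemma troot_subproof x k n : tcoord x (n.+1 + k) ^+ p = tcoord x (n + k).
Proof. by rewrite addSn tcoordP. Qed.

Definition troot k x : T := Tilt pr (troot_subproof x k).

Lemma tcoord_exp x k n : tcoord x (n + k) ^+ (p ^ k) = tcoord x n.
Proof.
elim: k n => [|k IH] n; first by rewrite addn0 expn0 expr1.
by rewrite addnS expnS exprM tcoordP IH.
Qed.

Lemma trootK k : cancel (troot k) (fun x => x ^+ (p ^ k)).
Proof. by move=> x; apply: tilt_eq => n; rewrite tcoordX tcoord_exp. Qed.

Lemma texpK k : cancel (fun x : T => x ^+ (p ^ k)) (troot k).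
Proof. by move=> x; apply: tilt_eq => n; rewrite /= tcoordX tcoord_exp. Qed.

Definition ppow_system (y : nat -> R) : Prop := forall n, y n.+1 ^+ p = y n.

Lemma tilt_of_subproof (y : nat -> R) (yP : ppow_system y) n :
  rproj (pideal (p%:R : R)) (y n.+1) ^+ p = rproj (pideal (p%:R : R)) (y n).
Proof. by rewrite -rmorphXn yP. Qed.

Definition tilt_of (y : nat -> R) (yP : ppow_system y) : T :=
  Tilt pr (tilt_of_subproof yP).

(* tseq x n is x^(n); when R is p-adically complete and separated, tilt_of is a
   bijection with inverse tseq, see tseqP and tseq_tilt_of *)
Definition tseq (x : T) : nat -> R :=
  xget (fun=> 0) [set y | exists yP : ppow_system y, tilt_of yP = x].

Definition sharp (x : T) : R := tseq x 0%N.

End TiltRing.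

Section AdicTopology.
Variables (A : comPzRingType) (a : A).

Definition adic_separated : Prop := forall x, (forall n, eqmod (a ^+ n) x 0) -> x = 0.

Definition adic_complete : Prop :=
  forall u : nat -> A, (forall n, eqmod (a ^+ n) (u n.+1) (u n)) ->
  exists l, forall n, eqmod (a ^+ n) (u n) l.

Definition adic_sum (u : nat -> A) : A :=
  xget 0 [set s | forall N, eqmod (a ^+ N) s (\sum_(n < N) u n * a ^+ n)].

Definition adic_closure (S : set A) : set A :=
  [set x | forall n, exists2 y, S y & eqmod (a ^+ n) y x].

Definition adic_closed (S : set A) : Prop := adic_closure S `<=` S.

End AdicTopology.

Section TiltSequences.
Variables (p : nat) (pr : prime p) (R : comPzRingType).
Hypothesis sepR : adic_separated (p%:R : R).
Hypothesis cplR : adic_complete (p%:R : R).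
Implicit Type x : tilt pr R.

Lemma adic_eq (y z : R) : (forall n, eqmod (p%:R ^+ n) y z) -> y = z.
Proof.
move=> yz; apply/eqP; rewrite -subr_eq0; apply/eqP/sepR => n.
by rewrite /eqmod subr0; exact: yz.
Qed.

Lemma ppow_systemX (y : nat -> R) k n : ppow_system p y -> y (n + k)%N ^+ (p ^ k) = y n.
Proof.
move=> yP; elim: k n => [|k IH] n; first by rewrite addn0 expn0 expr1.
by rewrite addnS expnS exprM yP IH.
Qed.

Lemma tilt_of_inj (y z : nat -> R) (yP : ppow_system p y) (zP : ppow_system p z) :
  tilt_of pr yP = tilt_of pr zP -> y = z.
Proof.
move=> yz; apply/funext => n; apply: adic_eq => k.
rewrite -(ppow_systemX k n yP) -(ppow_systemX k n zP).
apply: (@eqmod_le _ _ k (1 + k)) => //; apply: eqmod_exppX => //.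
rewrite expr1; apply/rproj_eq.
by have := congr1 (fun t => tcoord t (n + k)) yz.
Qed.

Lemma tilt_of_surj x : exists (y : nat -> R) (yP : ppow_system p y), tilt_of pr yP = x.
Proof.
pose r n := rrepr (tcoord x n); pose z n m := r (n + m)%N ^+ (p ^ m).
have rP n : eqmod p%:R (r n.+1 ^+ p) (r n).
  by apply/rproj_eq; rewrite rmorphXn /= !rreprK tcoordP.
have zP n m : eqmod (p%:R ^+ (1 + m)) (z n m.+1) (z n m).
  by rewrite /z addnS expnS exprM; apply: eqmod_exppX => //; rewrite expr1.
have lim n : exists l, forall m, eqmod (p%:R ^+ m) (z n m) l.
  by apply: cplR => m; exact: (@eqmod_le _ _ m (1 + m)).
have [y yl] := choice lim.
have yP : ppow_system p y.
  move=> n; apply: adic_eq => m.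
  apply: eqmod_trans (eqmodX p (eqmod_sym (yl n.+1 m))) _.
  have -> : z n.+1 m ^+ p = z n m.+1 by rewrite /z -exprM -expnSr addSnnS.
  by apply: (@eqmod_le _ _ m m.+1) => //; exact: yl.
exists y, yP; apply: tilt_eq => n /=; rewrite -[RHS]rreprK; apply/rproj_eq.
have := yl n 1%N; rewrite expr1 => /eqmod_sym /eqmod_trans; apply.
by rewrite /z addn1 expn1; exact: rP.
Qed.

Lemma tseqP x : exists yP : ppow_system p (tseq x), tilt_of pr yP = x.
Proof. exact: (xgetPex (fun=> 0) (tilt_of_surj x)). Qed.

Lemma tseq_tilt_of (y : nat -> R) (yP : ppow_system p y) : tseq (tilt_of pr yP) = y.
Proof. by have [zP /tilt_of_inj] := tseqP (tilt_of pr yP). Qed.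

End TiltSequences.

Section Perfectoid.
Variables (p : nat) (pr : prime p) (R : comPzRingType).
Local Notation W := (witt pr (tilt pr R)).

(* w is the sum of the [wdigit w n] p^n, by wdigitK and teich_series_sum *)
Definition wdigit (w : W) (n : nat) : tilt pr R := troot n (wcoord w n).

Lemma wdigitK : cancel wdigit (@teich_series p pr (tilt pr R)).
Proof. by move=> w; apply: wcoord_inj; apply/funext => n; rewrite /= trootK. Qed.

Lemma teich_seriesK : cancel (@teich_series p pr (tilt pr R)) wdigit.
Proof. by move=> x; apply/funext => n; rewrite /wdigit /= texpK. Qed.

Definition theta (w : W) : R := adic_sum p%:R (fun n => sharp (wdigit w n)).

Lemma thetaP : adic_complete (p%:R : R) -> forall w N,
  eqmod (p%:R ^+ N) (theta w) (\sum_(n < N) sharp (wdigit w n) * p%:R ^+ n).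
Proof.
move=> cpl w; pose S N := \sum_(n < N) sharp (wdigit w n) * p%:R ^+ n.
suff h : exists s, forall N, eqmod (p%:R ^+ N) s (S N) by exact: (xgetPex 0 h).
have [N|l lP] := cpl S; last by exists l => N; exact/eqmod_sym.
by exists (sharp (wdigit w N)); rewrite /S big_ord_recr /= addrAC subrr add0r mulrC.
Qed.

Definition perfectoid : Prop :=
  exists pi : R,
  [/\ adic_separated pi,
      adic_complete pi,
      pideal (pi ^+ p) p%:R,
      forall x : rquot (pideal (p%:R : R)), exists y, y ^+ p = x
    & exists d : W, [set w | theta w = 0] = pideal d].

End Perfectoid.

Definition perfectoid_ideal (p : nat) (pr : prime p) (R : comPzRingType) (J : set R) : Prop :=
  exists idJ : is_ideal J, perfectoid pr (rquot (Ideal idJ)).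

Definition is_radical (A : comPzRingType) (I : set A) : Prop :=
  forall (x : A) (n : nat), I (x ^+ n) -> I x.

Definition closed_radical_ideal (A : comPzRingType) (a : A) (I : set A) : Prop :=
  [/\ is_ideal I, is_radical I & adic_closed a I].

Section Untilting.
Variables (p : nat) (pr : prime p) (R : comPzRingType).

Definition tilt_ideal (J : set R) : set (tilt pr R) := [set x | forall n, J (tseq x n)].

Definition witt_ideal (I : set (tilt pr R)) : set (witt pr (tilt pr R)) :=
  [set teich_series pr x | x in [set x : nat -> tilt pr R | forall n, I (x n)]].

Definition untilt_ideal (I : set (tilt pr R)) : set R :=
  [set theta w | w in witt_ideal I].

End Untilting.

Arguments tilt_ideal {p} pr {R} J.
Arguments untilt_ideal {p pr R} I.

(* Main.v *)
(* Write t for p^flat, and let xi = [t] - p u in W(R^flat) with theta(u) = v. As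
   ker theta = (d), comparing xi = d e modulo p^2 shows that e_0, hence e, is a unit,
   so that ker theta = (xi). The same argument applies to S = R/J for J a perfectoid
   ideal and to the image of xi in W(S^flat). In particular S^flat -> S/p has kernel
   (t), so R^flat -> S^flat is surjective by t-adic approximation; its kernel is
   J^flat, which is therefore closed and radical. If x = theta(a) lies in J, the image
   of a in W(S^flat) is a multiple of xi, and subtracting a lift of it from a gives an
   element of W(J^flat) with the same image x under theta.
   Conversely let I be closed and radical, and S = R/theta(W(I)). The kernel of
   R^flat -> S/p is I + (t), and approximating along Frobenius identifies R^flat/I
   with S^flat. Thus S = W(S^flat)/(xi). This is p-adically separated because S^flat is
   reduced: if xi b is divisible by p^(n+1) then b is divisible by p^n. *)

From HB Require Import structures.
Require Import Defs.
From mathcomp Require Import all_boot all_order all_algebra.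
From mathcomp Require Import boolp classical_sets.
From mathcomp.multinomials Require Import monalg.
From mathcomp Require Import ring.

Set Implicit Arguments.
Unset Strict Implicit.
Unset Printing Implicit Defensive.

Import GRing.Theory.

Local Open Scope classical_set_scope.
Local Open Scope ring_scope.

(** * Adic topologies *)

Section Adic.
Variable A : comPzRingType.
Implicit Types a b c x y z : A.

Lemma eqmod_pideal a x y : eqmod a x y <-> exists c, x = y + a * c.
Proof.
split=> -[c h]; exists c; first by rewrite -h; ring.
by rewrite h; ring.
Qed.

Lemma adic_sep_eq a x y :
  adic_separated a -> (forall n, eqmod (a ^+ n) x y) -> x = y.
Proof.
move=> sep h; apply/eqP; rewrite -subr_eq0; apply/eqP/sep => n.
by rewrite /eqmod subr0; exact: h.
Qed.

Lemma adic_cauchy a (u : nat -> A) : (forall n, eqmod (a ^+ n) (u n.+1) (u n)) ->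
  forall m n, (m <= n)%N -> eqmod (a ^+ m) (u n) (u m).
Proof.
move=> h m n /subnKC <-; elim: (n - m)%N => [|k IH].
  by rewrite addn0; exact: eqmod_refl.
rewrite addnS; apply: eqmod_trans IH; apply: (eqmod_le (leq_addr k m)); exact: h.
Qed.

Lemma adic_limit a (u : nat -> A) : adic_complete a ->
  (forall n, eqmod (a ^+ n) (u n.+1) (u n)) ->
  exists l, forall n k, (k <= n)%N -> eqmod (a ^+ k) l (u n).
Proof.
move=> cpl h; have [l lP] := cpl u h; exists l => n k kn.
exact: eqmod_le kn (eqmod_sym (lP n)).
Qed.

Lemma adic_complete_series a : adic_complete a -> forall c : nat -> A,
  exists l, forall n, eqmod (a ^+ n) l (\sum_(k < n) a ^+ k * c k).
Proof.
move=> cpl c; have [n|l lP] := adic_limit (u := fun n => \sum_(k < n) a ^+ k * c k) cpl.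
  by rewrite big_ord_recr /=; exists (c n); rewrite addrAC subrr add0r.
by exists l => n; exact: lP.
Qed.

(* s n plays the role of the tail, the sum of the a^(k - n) c_k over k >= n. *)
Lemma series_adic_complete a :
  (forall c : nat -> A, exists s : nat -> A, forall n, s n = c n + a * s n.+1) ->
  adic_complete a.
Proof.
move=> sum u h; have [c cP] := choice h; have [s sP] := sum c.
have sE n : u n + a ^+ n * s n = u 0%N + s 0%N.
  elim: n => [|n <-]; first by rewrite mul1r.
  by rewrite (sP n) mulrDr addrA -cP exprSr; ring.
exists (u 0%N + s 0%N) => n; rewrite -(sE n); exists (- s n); ring.
Qed.

Lemma eqmod_expM_exp a b n x y : eqmod ((a * b) ^+ n) x y -> eqmod (a ^+ n) x y.
Proof. by rewrite exprMn; exact: eqmod_dvd. Qed.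

Lemma adic_separatedM a b : adic_separated a -> adic_separated (a * b).
Proof. by move=> sep x h; apply: sep => n; apply: (@eqmod_expM_exp a b). Qed.

(** The (a b)-adic series of the c_k is summed as the a-adic series of the b^k c_k. This carries
    completeness from pi to p, a multiple of pi in a perfectoid ring. *)
Lemma adic_completeM a b : adic_separated a -> adic_complete a -> adic_complete (a * b).
Proof.
move=> sep cpl; apply: series_adic_complete => c.
have [s sP] := choice (fun n => adic_complete_series cpl (fun k => b ^+ k * c (n + k)%N)).
exists s => n; apply: (adic_sep_eq sep) => N.
apply: eqmod_trans (eqmod_le (leqnSn N) (sP n N.+1)) _; apply: eqmod_sym.
have -> : \sum_(k < N.+1) a ^+ k * (b ^+ k * c (n + k)%N) =
    c n + a * b * \sum_(k < N) a ^+ k * (b ^+ k * c (n.+1 + k)%N).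
  rewrite big_ord_recl !expr0 !mul1r addn0 mulr_sumr; congr (_ + _).
  apply: eq_bigr => k _; rewrite lift0 addnS addSn !exprS; ring.
apply: eqmodD; first exact: eqmod_refl.
by apply: eqmodM; [exact: eqmod_refl|exact: sP].
Qed.

Lemma adic_separated_root a b v k : a ^+ k = v * b ->
  adic_separated b -> adic_separated a.
Proof.
move=> aE sep x h; apply: sep => n; apply: (@eqmod_expM_exp b v).
by rewrite mulrC -aE -exprM; exact: h.
Qed.

(** The subsequence u (k n) is Cauchy for b because b^n divides a^(k n). As v is a unit, b^n is also
    a multiple of a^(k n), so a b-adic limit is an a-adic one. *)
Lemma adic_complete_root a b v v' k : v * v' = 1 -> (0 < k)%N -> a ^+ k = v * b ->
  adic_complete b -> adic_complete a.
Proof.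
move=> vv' k0 aE cpl u h.
have leM n : (n <= k * n)%N by rewrite leq_pmull.
have [n|l lP] := cpl (fun n => u (k * n)%N).
  apply: (@eqmod_expM_exp b v); rewrite mulrC -aE -exprM.
  by apply: (adic_cauchy h); rewrite leq_mul2l leqnSn orbT.
exists l => n; apply: eqmod_trans (eqmod_sym (adic_cauchy h (leM n))) _.
apply: (eqmod_le (leM n)); rewrite exprM aE; have [c cE] := lP n.
exists (v' ^+ n * c); rewrite cE exprMn.
have vn : v ^+ n * v' ^+ n = 1 by rewrite -exprMn vv' expr1n.
by rewrite -[LHS]mul1r -vn; ring.
Qed.

(** The inverse is the geometric series in a y. *)
Lemma adic_unit1B a y : adic_separated a -> adic_complete a ->
  exists t, (1 - a * y) * t = 1.
Proof.
move=> sep cpl; have [t tP] := adic_complete_series cpl (fun k => y ^+ k).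
exists t; apply: (adic_sep_eq sep) => n.
apply: eqmod_trans (eqmodM (eqmod_refl _ _) (tP n)) _.
rewrite (eq_bigr (fun k : 'I_n => (a * y) ^+ k)) => [|k _]; last by rewrite exprMn.
exists (- y ^+ n); set S := \sum_(k < n) _.
have -> : (1 - a * y) * S - 1 = - ((a * y - 1) * S) - 1 by ring.
by rewrite -subrX1 exprMn; ring.
Qed.

End Adic.

(** * Tilts and Witt vectors *)

Section TiltAdic.
Variables (p : nat) (pr : prime p) (R : comPzRingType).
Local Notation T := (tilt pr R).
Implicit Types x y z t : T.

Lemma tcoordB x y n : tcoord (x - y) n = tcoord x n - tcoord y n.
Proof. by []. Qed.

Lemma tcoord_sum I (r : seq I) (F : I -> T) n :
  tcoord (\sum_(i <- r) F i) n = \sum_(i <- r) tcoord (F i) n.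
Proof. exact: (big_morph (fun x : T => tcoord x n) (fun _ _ => erefl)). Qed.

Lemma tilt_frobD x y : (x + y) ^+ p = x ^+ p + y ^+ p.
Proof. by apply: tilt_eq => n; rewrite tcoordX !tcoordD frobRpD // !tcoordX. Qed.

Lemma tilt_frobXD x y k : (x + y) ^+ (p ^ k) = x ^+ (p ^ k) + y ^+ (p ^ k).
Proof.
elim: k => [|k IH]; first by rewrite expn0 !expr1.
by rewrite expnSr !exprM IH tilt_frobD.
Qed.

(** Raising to the power p ^ k is injective on a tilt, with inverse [troot k], and k <= p ^ k. *)
Lemma tilt_reduced x k : x ^+ k = 0 -> x = 0.
Proof.
move=> xk; rewrite -(texpK k x).
have -> : x ^+ (p ^ k) = 0.
  by rewrite -(subnK (ltnW (ltn_expl k (prime_gt1 pr)))) exprD xk mulr0.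
apply: tilt_eq => n /=; first by [].
Qed.

Section Small.
Variable t : T.
Hypothesis t0 : tcoord t 0 = 0.

(** Coordinate m of t ^ (p ^ m) is coordinate 0 of t. Hence every coordinate is continuous for the
    t-adic topology. *)
Lemma tcoord_small m n : (p ^ m <= n)%N -> tcoord (t ^+ n) m = 0.
Proof.
move=> /subnK <-; rewrite exprD tcoordM !tcoordX -[X in X ^+ (p ^ m)]/(tcoord t (0 + m)).
by rewrite (tcoord_exp t m 0) t0 mulr0.
Qed.

Lemma tilt_adic_separated : adic_separated t.
Proof.
move=> x h; apply: tilt_eq => m; have [c cE] := h (p ^ m)%N.
by move: cE; rewrite subr0 => ->; rewrite tcoordM tcoord_small // mul0r.
Qed.

(** Only the first p ^ m terms of a t-adic series contribute to coordinate m, so the sum is defined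
    coordinatewise. *)
Lemma tilt_adic_complete : adic_complete t.
Proof.
apply: series_adic_complete => c.
pose S n m := \sum_(k < p ^ m) t ^+ k * c (n + k)%N.
have SE n m : forall M, (p ^ m <= M)%N ->
    tcoord (\sum_(k < M) t ^+ k * c (n + k)%N) m = tcoord (S n m) m.
  move=> M /subnKC <-; rewrite !tcoord_sum big_split_ord /=.
  rewrite -[RHS]addr0; congr (_ + _); apply: big1 => i _.
  by rewrite tcoord_small ?mul0r // leq_addr.
have sP n m : tcoord (S n m.+1) m.+1 ^+ p = tcoord (S n m) m.
  by rewrite tcoordP SE // leq_exp2l // prime_gt1.
exists (fun n => Tilt pr (sP n)) => n; apply: tilt_eq => m.
rewrite tcoordD tcoordM /= -(SE n m (p ^ m).+1) // big_ord_recl expr0 mul1r addn0.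
rewrite tcoordD -tcoordM; congr (_ + tcoord _ m); rewrite /S mulr_sumr.
by apply: eq_bigr => k _; rewrite lift0 exprS mulrA addSnnS.
Qed.

End Small.

(** The tilt is x-adically complete, with x itself in the role of [t]. *)
Lemma tilt_unit1B x : tcoord x 0 = 0 -> exists y, (1 - x) * y = 1.
Proof.
move=> x0.
have [y yP] := adic_unit1B 1 (tilt_adic_separated x0) (tilt_adic_complete x0).
by exists y; rewrite -[x]mulr1.
Qed.

End TiltAdic.

Section WittGeneral.
Variables (p : nat) (pr : prime p) (A : comPzRingType).
Local Notation W := (witt pr A).

Lemma ghost0 (a : nat -> A) : ghost p a 0 = a 0%N.
Proof. by rewrite /ghost big_ord1 expr0 mul1r expn0 expr1. Qed.

Definition wcoord0 (w : W) : A := wcoord w 0.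

(** Coordinate 0 is ghost component 0, hence compatible with the ring operations. *)
Lemma wcoord0_is_zmod_morphism : zmod_morphism wcoord0.
Proof.
move=> u v; rewrite /wcoord0 -[LHS]/(wadd p (wcoord u) (wopp p (wcoord v)) 0%N).
have c0 a := esym (ghost0 a); rewrite (c0 (wadd _ _ _)) ghost_wadd // !ghost0.
by rewrite (c0 (wopp _ _)) ghost_wopp // ghost0.
Qed.

HB.instance Definition _ :=
  GRing.isZmodMorphism.Build W A wcoord0 wcoord0_is_zmod_morphism.

Lemma wcoord0_is_monoid_morphism : monoid_morphism wcoord0.
Proof.
split=> // u v; rewrite /wcoord0 -[LHS]/(wmul p (wcoord u) (wcoord v) 0%N).
by rewrite -[LHS](ghost0 (wmul _ _ _)) ghost_wmul // !ghost0.
Qed.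

HB.instance Definition _ :=
  GRing.isMonoidMorphism.Build W A wcoord0 wcoord0_is_monoid_morphism.

Lemma teich0 : teich pr (0 : A) = 0.
Proof. by apply: wcoord_inj; apply/funext => -[]. Qed.

(** After lifting x and y to a polynomial ring, ghost components determine a Witt vector, and those
    of [x] are the powers x ^ (p ^ n). *)
Lemma teichM (x y : A) : teich pr (x * y) = teich pr x * teich pr y.
Proof.
have [X XE] : exists X, peps A X = x by exists (pvar x); exact: peval_var.
have [Y YE] : exists Y, peps A Y = y by exists (pvar y); exact: peval_var.
have hx := wlift_teich pr X; rewrite XE in hx.
have hy := wlift_teich pr Y; rewrite YE in hy.
have hxy := wlift_teich pr (X * Y).
rewrite [peps A (X * Y)](rmorphM (peps A)) XE YE in hxy.
apply: wcoord_inj; apply: (wlift_eq pr hxy (wliftM pr hx hy)) => n.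
exact: exprMn.
Qed.

Lemma wcoord0_teich (x : A) : wcoord0 (teich pr x) = x.
Proof. by []. Qed.

End WittGeneral.

Section WittMap.
Variables (p : nat) (pr : prime p) (A B : comPzRingType) (h : {rmorphism A -> B}).

Definition wmap (w : witt pr A) : witt pr B := Witt pr (h \o wcoord w).

Lemma wmap_is_zmod_morphism : zmod_morphism wmap.
Proof.
move=> u v; apply: wcoord_inj.
by rewrite -[LHS]/(h \o wadd p (wcoord u) (wopp p (wcoord v))) comp_wadd comp_wopp.
Qed.

HB.instance Definition _ :=
  GRing.isZmodMorphism.Build (witt pr A) (witt pr B) wmap wmap_is_zmod_morphism.

Lemma wmap_is_monoid_morphism : monoid_morphism wmap.
Proof.
split=> [|u v]; apply: wcoord_inj.
  by rewrite -[LHS]/(h \o wteich 1) comp_wteich rmorph1.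
by rewrite -[LHS]/(h \o wmul p (wcoord u) (wcoord v)) comp_wmul.
Qed.

HB.instance Definition _ :=
  GRing.isMonoidMorphism.Build (witt pr A) (witt pr B) wmap wmap_is_monoid_morphism.

Lemma wmap_teich x : wmap (teich pr x) = teich pr (h x).
Proof. by apply: wcoord_inj; exact: comp_wteich. Qed.

Lemma wmap_eq0 w : wmap w = 0 <-> forall n, h (wcoord w n) = 0.
Proof.
split=> [e n|e]; first by have := congr1 (fun u => wcoord u n) e.
by apply: wcoord_inj; apply/funext => n; exact: e.
Qed.

Lemma wmap_surj : (forall y, exists x, h x = y) -> forall w, exists u, wmap u = w.
Proof.
move=> /choice [g gK] w; exists (Witt pr (g \o wcoord w)).
by apply: wcoord_inj; apply/funext => n /=; rewrite gK.
Qed.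

End WittMap.

(** This identity and the next are stated in an arbitrary ring, so that [ring] never meets the
    operations of Witt vectors. *)
Lemma subr_affine (A : comPzRingType) (q t x y u v : A) :
  u = t + q * x -> v = t + q * y -> u - v = q * (x - y).
Proof. by move=> -> ->; ring. Qed.

Lemma unit_mul1B (A : comPzRingType) (q e x s t : A) :
  1 - e * x = q * s -> (1 - q * s) * t = 1 -> e * (x * t) = 1.
Proof. by move=> <- <-; ring. Qed.

(** * Witt vectors of a tilt *)

Section WittTilt.
Variables (p : nat) (pr : prime p) (R : comPzRingType).
Local Notation T := (tilt pr R).
Local Notation W := (witt pr T).
Implicit Types u v w : W.

(** This is (w - [w_0]) / p, obtained by dropping the first Teichmuller digit. *)
Definition wshift w : W := teich_series pr (fun n => wdigit w n.+1).

Lemma wdigit0 w : wdigit w 0 = wcoord w 0.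
Proof. by apply: tilt_eq => n; rewrite /= addn0. Qed.

Lemma wsplit w : w = teich pr (wcoord w 0) + p%:R * wshift w.
Proof. by rewrite -{1}[w]wdigitK teich_seriesS ?wdigit0 //; exact: charT. Qed.

Lemma wdigit_shift w n : wdigit (wshift w) n = wdigit w n.+1.
Proof. by rewrite /wshift teich_seriesK. Qed.

(** In characteristic p, multiplication by p shifts the coordinates and raises them to the power p,
    and a tilt is reduced. *)
Lemma witt_p_inj : injective (fun w => p%:R * w).
Proof.
move=> u v /eqP; rewrite -subr_eq0 -mulrBr => /eqP e; apply/eqP; rewrite -subr_eq0.
apply/eqP/wcoord_inj/funext => n.
have := congr1 (fun w => wcoord w n.+1) e; rewrite wcoord_pM; last exact: charT.
exact: tilt_reduced.
Qed.

Lemma witt_coord0_eq0 w : wcoord w 0 = 0 -> w = p%:R * wshift w.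
Proof. by move=> w0; rewrite {1}[w]wsplit w0 teich0 add0r. Qed.

Lemma wcoord_pXM n w i : (i < n)%N -> wcoord (p%:R ^+ n * w) i = 0.
Proof.
elim: n i => // n IH i lti; rewrite exprS -mulrA wcoord_pM; last exact: charT.
by case: i lti => // i lti; rewrite -[LHS]/(wcoord (_ * w) i ^+ p) IH // exp0p.
Qed.

Lemma witt_adic_separated : adic_separated (p%:R : W).
Proof.
move=> w h; apply: wcoord_inj; apply/funext => i; have [c cE] := h i.+1.
by move: cE; rewrite subr0 => ->; rewrite wcoord_pXM.
Qed.

(** By induction on n: once the digits 0 agree, u - v is p times the difference of the shifts, and p
    can be cancelled. *)
Lemma witt_eqmod_digits n u v :
  eqmod (p%:R ^+ n) u v <-> forall i, (i < n)%N -> wdigit u i = wdigit v i.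
Proof.
elim: n u v => [|n IH] u v.
  by split=> // _; exists (u - v); rewrite mul1r.
have shiftB : wcoord u 0 = wcoord v 0 -> u - v = p%:R * (wshift u - wshift v).
  by move=> uv0; have vE := wsplit v; rewrite -uv0 in vE; exact: subr_affine (wsplit u) vE.
have pS c : p%:R * (p%:R ^+ n * c) = p%:R ^+ n.+1 * c :> W by rewrite exprS mulrA.
split=> [[c cE]|uv].
  have uv0 : wcoord u 0 = wcoord v 0.
    apply/eqP; rewrite -subr_eq0; apply/eqP.
    by rewrite -[LHS](rmorphB (wcoord0 (pr:=pr) (A:=T))) cE; exact: wcoord_pXM.
  move=> [|i] lti; first by rewrite !wdigit0.
  rewrite -!wdigit_shift; move: i lti; apply/IH.
  exists c; apply: (@witt_p_inj (_ - _)); rewrite pS; exact: etrans (esym (shiftB uv0)) cE.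
have /IH [c cE] : forall i, (i < n)%N -> wdigit (wshift u) i = wdigit (wshift v) i.
  by move=> i lti; rewrite !wdigit_shift uv.
exists c; rewrite shiftB; last by rewrite -!wdigit0 uv.
by rewrite cE pS.
Qed.

Lemma witt_adic_complete : adic_complete (p%:R : W).
Proof.
(* Digit k is determined modulo p ^ (k + 1), so it is constant from u (k + 1) on. *)
move=> u h; exists (teich_series pr (fun k => wdigit (u k.+1) k)) => n.
apply/witt_eqmod_digits => i lti; rewrite teich_seriesK.
by move/witt_eqmod_digits: (adic_cauchy h lti); exact.
Qed.

(** The product e [x] has the form 1 - p s, which a p-adic geometric series inverts. *)
Lemma witt_unit (e : W) : (exists x, wcoord e 0 * x = 1) -> exists f, e * f = 1.
Proof.
move=> [x ex]; pose w := 1 - e * teich pr x.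
have /witt_coord0_eq0 wE : wcoord w 0 = 0.
  have -> : wcoord w 0 = 1 - wcoord e 0 * x.
    by rewrite -[LHS]/(wcoord0 w) rmorphB rmorph1 rmorphM.
  by rewrite ex subrr.
have [t tP] := adic_unit1B (wshift w) (@witt_adic_separated) (@witt_adic_complete).
by exists (teich pr x * t); exact: unit_mul1B wE tP.
Qed.

End WittTilt.

(** * The kernel of theta *)

(* W, q and te stand for the Witt vectors of A, the prime p and the Teichmuller map;
   they are kept abstract because unification on witt unfolds the Witt polynomials. *)
Section Distinguished.
Variables (W A : comPzRingType) (q : W) (c : {rmorphism W -> A}) (te : A -> W).
Hypotheses (te0 : te 0 = 0) (teM : forall x y, te (x * y) = te x * te y).
Hypotheses (cte : forall x, c (te x) = x) (cq : c q = 0).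
Hypothesis q_inj : injective (fun w => q * w).
Hypothesis split_te : forall w, exists w', w = te (c w) + q * w'.

(** Expand d = [d_0] + p d' and e = [e_0] + p e'. The terms [t] and [d_0 e_0] cancel, one factor p
    can be cancelled from the rest, and coordinate 0 gives the second relation. *)
Lemma distinguished_factor t u d e : te t - q * u = d * e ->
  t = c d * c e /\ exists d' e', - c u = c d * e' + c e * d'.
Proof.
move=> h; have tE : t = c d * c e.
  by have := congr1 c h; rewrite rmorphB !rmorphM cte cq mul0r subr0.
split=> //; have [d' dE] := split_te d; have [e' eE] := split_te e.
exists (c d'), (c e').
have /(congr1 c) : - u = te (c d) * e' + te (c e) * d' + q * (d' * e').
  apply: q_inj; apply: (addrI (te t)); rewrite mulrN h {1}dE {1}eE tE teM; ring.
by rewrite rmorphN !rmorphD !rmorphM !cte cq mul0r addr0.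
Qed.

Variables (t : A) (u : W) (u' : A).
Hypothesis u_unit : c u * u' = 1.
Hypothesis reduced : forall (x : A) n, x ^+ n = 0 -> x = 0.
Local Notation xi := (te t - q * u).

(* Writing b = [b_0] + p b_1, divisibility by p^2 gives t b_0 = 0 and t c(b_1) = u_0 b_0,
   so (t c(b_1))^2 = 0 and b_0 = 0. *)
Lemma distinguished_dvd n b z : xi * b = q ^+ n.+1 * z -> exists b', b = q ^+ n * b'.
Proof.
elim: n b => [|n IH] b h; first by exists b; rewrite mul1r.
have [b1 bE] := split_te b; set b0 := c b in bE.
have tb0 : t * b0 = 0.
  have <- : c (xi * b) = t * b0 by rewrite rmorphM rmorphB rmorphM cte cq mul0r subr0.
  by rewrite h rmorphM rmorphXn cq expr0n mul0r.
have h1 : xi * b1 - u * te b0 = q ^+ n.+1 * z.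
  apply: q_inj; rewrite mulrA -exprS -h bE.
  have -> : xi * (te b0 + q * b1) = te t * te b0 - q * u * te b0 + q * (xi * b1) by ring.
  by rewrite -teM tb0 te0; ring.
have b0E : t * c b1 = c u * b0.
  apply/eqP; rewrite -subr_eq0; apply/eqP.
  have <- : c (xi * b1 - u * te b0) = t * c b1 - c u * b0.
    by rewrite rmorphB !rmorphM rmorphB rmorphM !cte cq mul0r subr0.
  by rewrite h1 rmorphM rmorphXn cq expr0n mul0r.
have tb1 : t * c b1 = 0.
  apply: (@reduced _ 2); have -> : (t * c b1) ^+ 2 = c b1 * t * (t * c b1) by ring.
  by rewrite b0E mulrCA -[_ * t * b0]mulrA tb0 !mulr0.
have b00 : b0 = 0 by rewrite -[b0]mul1r -u_unit mulrAC -b0E tb1 mul0r.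
move: h1 bE; rewrite b00 te0 mulr0 subr0 add0r => /IH [b' ->] bE.
by exists b'; rewrite bE exprS mulrA.
Qed.

Hypotheses (sep : adic_separated q) (cpl : adic_complete q).

(** By [distinguished_dvd] the approximate quotients b form a Cauchy sequence, and its limit is an
    exact quotient. *)
Lemma distinguished_closed a :
  (forall n, exists b z, a = xi * b + q ^+ n * z) -> exists b, a = xi * b.
Proof.
move=> h; have [b bP] := choice h; have [z zP] := choice bP.
(* [distinguished_dvd] loses one power of p, which the shift from b n to b (n + 1) makes up for. *)
have [n|l lP] := adic_limit (u := fun n => b n.+1) cpl.
  have [|b' b'E] := @distinguished_dvd n (b n.+2 - b n.+1) (z n.+1 - q * z n.+2).
    have e : xi * b n.+2 + q ^+ n.+2 * z n.+2 = xi * b n.+1 + q ^+ n.+1 * z n.+1.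
      by rewrite -!zP.
    by move/(canRL (addrK _)): e => e; rewrite mulrBr e !exprS; ring.
  by exists b'.
exists l; apply: (adic_sep_eq sep) => n; have [m mE] := lP n n (leqnn n).
exists (q * z n.+1 - xi * m).
have -> : l = b n.+1 + q ^+ n * m by rewrite -mE; ring.
by rewrite {1}(zP n.+1) exprS; ring.
Qed.

End Distinguished.

(** * Theta as a ring morphism *)

Section Theta.
Variables (p : nat) (pr : prime p) (R : comPzRingType).
Local Notation T := (tilt pr R).
Local Notation W := (witt pr T).
Hypothesis sepR : adic_separated (p%:R : R).
Hypothesis cplR : adic_complete (p%:R : R).

Lemma tseqP_pow (x : T) : ppow_system p (tseq x).
Proof. by have [] := tseqP sepR cplR x. Qed.

Lemma tcoord_tseq (x : T) n : tcoord x n = rproj (pideal (p%:R : R)) (tseq x n).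
Proof. by have [yP {1}<-] := tseqP sepR cplR x. Qed.

Lemma tseq_eq (y : nat -> R) (x : T) : ppow_system p y ->
  (forall n, tcoord x n = rproj (pideal (p%:R : R)) (y n)) -> tseq x = y.
Proof.
move=> yP xy; rewrite -(tseq_tilt_of pr sepR cplR yP); congr tseq.
by apply: tilt_eq => n; rewrite xy.
Qed.

Lemma tseq_troot k (x : T) n : tseq (troot k x) n = tseq x (n + k).
Proof.
rewrite (@tseq_eq (fun n => tseq x (n + k)%N)) //= => m; first by rewrite addSn tseqP_pow.
exact: tcoord_tseq.
Qed.

(** Raising to the power p ^ (n - i) improves a congruence modulo p to one modulo p ^ (n - i + 1),
    and the factor p ^ i supplies the rest. *)
Lemma eqmod_ghost (a b : nat -> R) n :
  (forall i, (i <= n)%N -> eqmod p%:R (a i) (b i)) ->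
  eqmod (p%:R ^+ n.+1) (ghost p a n) (ghost p b n).
Proof.
move=> ab; apply: eqmod_sum => i _.
have ilen : (i <= n)%N by rewrite -ltnS.
have -> : p%:R ^+ n.+1 = p%:R ^+ i * p%:R ^+ (1 + (n - i)) :> R.
  by rewrite -exprD add1n addnS subnKC.
by apply: eqmod_mull; apply: eqmod_exppX => //; rewrite expr1; exact: ab.
Qed.

(* Modulo p^(n+1), theta factors through the n-th projection W(R^flat) -> W(R/p)
   followed by the n-th ghost component of a lift; both are ring morphisms. *)
Lemma theta_ghost (w : W) (b : nat -> R) n :
  (forall i, tcoord (wcoord w i) n = rproj (pideal (p%:R : R)) (b i)) ->
  eqmod (p%:R ^+ n.+1) (theta w) (ghost p b n).
Proof.
move=> wb; apply: eqmod_trans (thetaP cplR w n.+1) _.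
apply: (@eqmod_trans _ _ (ghost p (fun i => tseq (wcoord w i) n) n)); last first.
  by apply: eqmod_ghost => i _; apply/rproj_eq; rewrite -tcoord_tseq.
rewrite /ghost; apply: eqmod_sum => i _.
rewrite /sharp /wdigit tseq_troot mulrC.
have -> : tseq (wcoord w i) (0 + i) = tseq (wcoord w i) n ^+ (p ^ (n - i)); last exact: eqmod_refl.
rewrite add0n -(ppow_systemX (n - i) i (@tseqP_pow _)) subnKC //.
by rewrite -ltnS.
Qed.

Lemma theta_eq_ghost (w : W) (x : R) :
  (forall n, exists2 b : nat -> R,
     (forall i, tcoord (wcoord w i) n = rproj (pideal (p%:R : R)) (b i))
     & eqmod (p%:R ^+ n.+1) (ghost p b n) x) -> theta w = x.
Proof.
move=> h; apply: (adic_sep_eq sepR) => n; have [b /theta_ghost wb bx] := h n.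
by apply: (eqmod_le (leqnSn n)); exact: eqmod_trans wb bx.
Qed.

(** The index comes first so that a fixed n gives a ring morphism from the tilt to R/p. *)
Let tc (n : nat) (x : T) := tcoord x n.

Lemma tcoord_is_zmod_morphism n : zmod_morphism (tc n). Proof. by []. Qed.
Lemma tcoord_is_monoid_morphism n : monoid_morphism (tc n). Proof. by []. Qed.

HB.instance Definition _ n := GRing.isZmodMorphism.Build _ _ (tc n) (tcoord_is_zmod_morphism n).
HB.instance Definition _ n := GRing.isMonoidMorphism.Build _ _ (tc n) (tcoord_is_monoid_morphism n).

Lemma theta_lift (w : W) n : exists2 b : nat -> R,
  tc n \o wcoord w = rproj (pideal (p%:R : R)) \o b
  & eqmod (p%:R ^+ n.+1) (ghost p b n) (theta w).
Proof.
exists (fun i => tseq (wcoord w i) n); first by apply/funext => i; exact: tcoord_tseq.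
by apply/eqmod_sym/theta_ghost => i; exact: tcoord_tseq.
Qed.

Lemma theta_is_zmod_morphism : zmod_morphism (@theta p pr R).
Proof.
move=> u v; apply: theta_eq_ghost => n.
have [a ua au] := theta_lift u n; have [b vb bv] := theta_lift v n.
exists (wadd p a (wopp p b)); last first.
  by rewrite ghost_wadd // ghost_wopp //; apply: eqmodD => //; exact: eqmodN.
(* The Witt operations are natural, so they commute both with [tc n] and with the projection R ->
   R/p. *)
move=> i; rewrite -[RHS]/((rproj _ \o _) i) comp_wadd comp_wopp -ua -vb.
by rewrite -comp_wopp -comp_wadd.
Qed.

Lemma theta_is_monoid_morphism : monoid_morphism (@theta p pr R).
Proof.
split=> [|u v]; apply: theta_eq_ghost => n.
  exists (wteich 1); last by rewrite ghost_wteich // expr1n; exact: eqmod_refl.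
  by move=> -[|i]; rewrite [wteich _ _]/= ?rmorph0 ?rmorph1.
have [a ua au] := theta_lift u n; have [b vb bv] := theta_lift v n.
exists (wmul p a b); last by rewrite ghost_wmul //; exact: eqmodM.
move=> i; rewrite -[RHS]/((rproj _ \o _) i) comp_wmul -ua -vb.
by rewrite -comp_wmul.
Qed.

Lemma theta_teich (x : T) : theta (teich pr x) = sharp x.
Proof.
apply: theta_eq_ghost => n; exists (wteich (tseq x n)).
  by move=> [|i]; rewrite [wteich _ _]/= ?rmorph0 //; exact: tcoord_tseq.
rewrite ghost_wteich // /sharp -(ppow_systemX n 0 (@tseqP_pow x)).
exact: eqmod_refl.
Qed.

Lemma theta_mod_p (w : W) : rproj (pideal (p%:R : R)) (theta w) = tcoord (wcoord w 0) 0.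
Proof.
rewrite tcoord_tseq; apply/rproj_eq.
rewrite -[tseq _ _]/(sharp (wcoord w 0)) -wdigit0.
by have := thetaP cplR w 1; rewrite expr1 big_ord1 mulr1.
Qed.

End Theta.

Section ThetaRing.
Variables (p : nat) (pr : prime p) (R : comPzRingType).
Local Notation T := (tilt pr R).
Local Notation W := (witt pr T).
Hypothesis sepR : adic_separated (p%:R : R).
Hypothesis cplR : adic_complete (p%:R : R).

(* The proof arguments only serve to attach the morphism structure. *)
Definition theta_rmorph (sep : adic_separated (p%:R : R)) (cpl : adic_complete (p%:R : R)) :
  W -> R := @theta p pr R.

HB.instance Definition _ :=
  GRing.isZmodMorphism.Build W R (theta_rmorph sepR cplR) (theta_is_zmod_morphism sepR cplR).
HB.instance Definition _ :=
  GRing.isMonoidMorphism.Build W R (theta_rmorph sepR cplR) (theta_is_monoid_morphism pr sepR cplR).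

Lemma thetaB (x y : W) : theta (x - y) = theta x - theta y.
Proof. exact: (rmorphB (theta_rmorph sepR cplR)). Qed.

Lemma thetaD (x y : W) : theta (x + y) = theta x + theta y.
Proof. exact: (rmorphD (theta_rmorph sepR cplR)). Qed.

Lemma thetaM (x y : W) : theta (x * y) = theta x * theta y.
Proof. exact: (rmorphM (theta_rmorph sepR cplR)). Qed.

Lemma theta0 : theta (0 : W) = 0.
Proof. exact: (rmorph0 (theta_rmorph sepR cplR)). Qed.

Lemma theta1 : theta (1 : W) = 1.
Proof. exact: (rmorph1 (theta_rmorph sepR cplR)). Qed.

Lemma theta_pX n : theta (p%:R ^+ n : W) = p%:R ^+ n.
Proof.
by rewrite -[LHS]/(theta_rmorph sepR cplR _) rmorphXn rmorph_nat.
Qed.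

Hypothesis frobR : forall x : rquot (pideal (p%:R : R)), exists y, y ^+ p = x.

Lemma tcoord0_surj (x : rquot (pideal (p%:R : R))) : exists t : T, tcoord t 0 = x.
Proof.
have [r rP] := choice frobR.
have yP n : iter n.+1 r x ^+ p = iter n r x by rewrite iterS rP.
by exists (Tilt pr yP).
Qed.

Lemma sharp_approx (x : R) : exists (t : T) (y : R), x = sharp t + p%:R * y.
Proof.
have [t tE] := tcoord0_surj (rproj _ x); exists t.
by apply/eqmod_pideal/rproj_eq; rewrite -tE (tcoord_tseq sepR cplR).
Qed.

Lemma theta_surj (x : R) : exists a : W, theta a = x.
Proof.
have [t /choice [y tyP]] := choice sharp_approx.
(* Iterating x = (t x)^sharp + p (y x) expands x p-adically; [iter n y x] is the remainder after n
   digits. *)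
exists (teich_series pr (fun n => t (iter n y x))).
apply: (adic_sep_eq sepR) => n; apply: eqmod_trans (thetaP cplR _ n) _.
under eq_bigr do rewrite teich_seriesK.
apply/eqmod_sym/eqmod_pideal; exists (iter n y x).
elim: n => [|n IH]; first by rewrite big_ord0 add0r mul1r.
rewrite big_ord_recr iterS /= [LHS]IH [X in _ + _ * X = _](tyP (iter n y x)) exprS.
by ring.
Qed.

End ThetaRing.

(** * Generators of the kernel of theta in a perfectoid ring *)

Section Perfectoids.
Variables (p : nat) (pr : prime p) (R : comPzRingType).
Local Notation T := (tilt pr R).
Local Notation W := (witt pr T).
Local Notation xi t u := (teich pr t - p%:R * u).

Lemma perfectoid_adic : perfectoid pr R ->
  adic_separated (p%:R : R) /\ adic_complete (p%:R : R).
Proof.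
move=> [pi [sep cpl [c pE] _ _]].
have -> : p%:R = pi * (pi ^+ p.-1 * c) :> R.
  by rewrite mulrA -exprS prednK ?prime_gt0 // -pE.
by split; [exact: adic_separatedM|exact: adic_completeM].
Qed.

Lemma wcoord0_p : wcoord0 (p%:R : W) = 0.
Proof. by rewrite rmorph_nat; exact: charT. Qed.

Lemma wcoord0_Bp (a b : W) : wcoord0 (a - p%:R * b) = wcoord0 a.
Proof. by rewrite rmorphB rmorphM [X in X * _]wcoord0_p mul0r subr0. Qed.

Lemma witt_split (w : W) : exists w', w = teich pr (wcoord0 w) + p%:R * w'.
Proof. by exists (wshift w); exact: wsplit. Qed.

Hypothesis perfR : perfectoid pr R.
Variables (t u0 : T) (u : W).
Hypothesis xi0 : theta (xi t u) = 0.
Hypothesis u_unit : wcoord u 0 * u0 = 1.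

Lemma theta_kernel (w : W) : theta w = 0 -> exists b, w = xi t u * b.
Proof.
have [sepR cplR] := perfectoid_adic perfR.
have [pi [_ _ _ _ [d kerd]]] := perfR.
have kerE a : theta a = 0 <-> pideal d a by rewrite -[theta a = 0]/([set w | theta w = 0] a) kerd.
have /kerE [e xiE] := xi0.
have [_ [d' [e' uE]]] := distinguished_factor (@teichM p pr T) (@wcoord0_teich p pr T)
  wcoord0_p (@witt_p_inj p pr R) witt_split xiE.
have d0 : tcoord (wcoord d 0) 0 = 0.
  rewrite -(theta_mod_p sepR cplR) (_ : theta d = 0) ?rmorph0 //; apply/kerE.
  by exists 1; rewrite mulr1.
have small : tcoord (- (wcoord d 0 * (e' * u0))) 0 = 0.
  by rewrite -[LHS]/(- (tcoord (wcoord d 0) 0 * _)) d0 mul0r oppr0.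
have [z zP] := tilt_unit1B small.
(* Multiplying - u_0 = d_0 e' + e_0 d' by [u0] gives e_0 (- d' u0) = 1 + d_0 e' u0. The right side
   has inverse z because d_0 vanishes in R/p. *)
have [|f ef] := @witt_unit p pr R e; first exists (- (d' * u0 * z)).
  have {}uE : wcoord u 0 = - (wcoord d 0 * e' + wcoord e 0 * d').
    by rewrite -[LHS]opprK; congr (- _).
  by rewrite -zP -u_unit uE; ring.
move=> /kerE [b ->]; exists (f * b).
by rewrite xiE mulrA -[d * e * f]mulrA ef mulr1.
Qed.

(** If s^sharp = p theta(b), then [s] - p b is a multiple of xi; in coordinate 0 this says that s is
    a multiple of t. *)
Lemma tilt_kernel (s : T) : tcoord s 0 = 0 -> exists s', s = t * s'.
Proof.
have [sepR cplR] := perfectoid_adic perfR.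
have [pi [_ _ _ frobR _]] := perfR.
rewrite (tcoord_tseq sepR cplR) -(rmorph0 (rproj _)) => /rproj_eq [y].
rewrite subr0 -[tseq s 0]/(sharp s) => sE.
have [b bE] := theta_surj pr sepR cplR frobR y.
have [|c cE] := @theta_kernel (teich pr s - p%:R * b).
  have thp := theta_pX pr sepR cplR 1; rewrite !expr1 in thp.
  by rewrite thetaB // thetaM // theta_teich // thp bE sE subrr.
exists (wcoord0 c); have := congr1 (@wcoord0 p pr T) cE.
by rewrite wcoord0_Bp rmorphM [X in X * _]wcoord0_Bp.
Qed.

End Perfectoids.

(** * Functoriality of the tilt and of theta *)

Section TiltMap.
Variables (p : nat) (pr : prime p) (R S : comPzRingType) (h : {rmorphism R -> S}).

Lemma rmorph_eqmod a x y : eqmod a x y -> eqmod (h a) (h x) (h y).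
Proof. by move=> [c cE]; exists (h c); rewrite -rmorphB cE rmorphM. Qed.

Definition rmod (x : rquot (pideal (p%:R : R))) : rquot (pideal (p%:R : S)) :=
  rproj _ (h (rrepr x)).

Lemma rmodE x : rmod (rproj _ x) = rproj _ (h x).
Proof.
apply/rproj_eq; rewrite -[pideal _ _]/(eqmod _ _ _) -(rmorph_nat h p).
by apply: rmorph_eqmod; apply/rproj_eq; rewrite rreprK.
Qed.

Lemma rmod_is_zmod_morphism : zmod_morphism rmod.
Proof. by move=> x y; rewrite -(rreprK x) -(rreprK y) -rmorphB !rmodE !rmorphB. Qed.

HB.instance Definition _ := GRing.isZmodMorphism.Build _ _ rmod rmod_is_zmod_morphism.

Lemma rmod_is_monoid_morphism : monoid_morphism rmod.
Proof.
split; first by rewrite -(rmorph1 (rproj _)) rmodE !rmorph1.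
by move=> x y; rewrite -(rreprK x) -(rreprK y) -rmorphM !rmodE !rmorphM.
Qed.

HB.instance Definition _ := GRing.isMonoidMorphism.Build _ _ rmod rmod_is_monoid_morphism.

Lemma tmap_subproof (x : tilt pr R) n : rmod (tcoord x n.+1) ^+ p = rmod (tcoord x n).
Proof. by rewrite -rmorphXn tcoordP. Qed.

Definition tmap (x : tilt pr R) : tilt pr S := Tilt pr (tmap_subproof x).

Lemma tmap_is_zmod_morphism : zmod_morphism tmap.
Proof. by move=> x y; apply: tilt_eq => n; exact: rmorphB. Qed.

HB.instance Definition _ := GRing.isZmodMorphism.Build _ _ tmap tmap_is_zmod_morphism.

Lemma tmap_is_monoid_morphism : monoid_morphism tmap.
Proof.
by split=> [|x y]; apply: tilt_eq => n; [exact: rmorph1|exact: rmorphM].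
Qed.

HB.instance Definition _ := GRing.isMonoidMorphism.Build _ _ tmap tmap_is_monoid_morphism.

Hypotheses (sepR : adic_separated (p%:R : R)) (cplR : adic_complete (p%:R : R)).
Hypotheses (sepS : adic_separated (p%:R : S)) (cplS : adic_complete (p%:R : S)).

Lemma tseq_tmap (x : tilt pr R) n : tseq (tmap x) n = h (tseq x n).
Proof.
rewrite (@tseq_eq p pr S sepS cplS (h \o tseq x)) //= => m.
  by rewrite -rmorphXn tseqP_pow.
by rewrite (tcoord_tseq sepR cplR) rmodE.
Qed.

Lemma theta_wmap (w : witt pr (tilt pr R)) : theta (wmap tmap w) = h (theta w).
Proof.
apply: (theta_eq_ghost sepS cplS) => n; have [b wb bw] := theta_lift sepR cplR w n.
exists (h \o b) => [i /=|].
  by have /= -> := congr1 (fun f => f i) wb; rewrite rmodE.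
by rewrite -rmorph_ghost -(rmorph_nat h p) -rmorphXn; exact: rmorph_eqmod.
Qed.

End TiltMap.

(** * Perfectoid ideals and their tilts *)

Section QuotientFacts.
Variables (R : comPzRingType) (J : ideal R).

Lemma rproj_eq0 x : rproj J x = 0 <-> J x.
Proof. by rewrite -(rmorph0 (rproj J)) rproj_eq subr0. Qed.

Lemma rproj_surj (y : rquot J) : exists x, rproj J x = y.
Proof. by exists (rrepr y); exact: rreprK. Qed.

(** The increments of a Cauchy sequence lift one by one to multiples of a ^ n, so the sequence lifts
    to a Cauchy sequence in R. *)
Lemma rquot_adic_complete a : adic_complete a -> adic_complete (rproj J a).
Proof.
move=> cpl x h.
have lift n : exists c, x n.+1 = x n + rproj J a ^+ n * rproj J c.
  have /eqmod_pideal [c ->] := h n; have [d <-] := rproj_surj c.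
  by exists d.
have [c cE] := choice lift; have [y0 y0E] := rproj_surj (x 0%N).
pose y n := y0 + \sum_(k < n) a ^+ k * c k.
have yS n : y n.+1 = y n + a ^+ n * c n by rewrite /y big_ord_recr addrA.
have yE n : rproj J (y n) = x n.
  elim: n => [|n IH]; first by rewrite /y big_ord0 addr0.
  by rewrite yS rmorphD /= IH cE rmorphM rmorphXn.
have [n|l lP] := cpl y; first by apply/eqmod_pideal; exists (c n).
exists (rproj J l) => n; rewrite -yE -rmorphXn; exact: rmorph_eqmod.
Qed.

End QuotientFacts.

Section WittIdeal.
Variables (p : nat) (pr : prime p) (R : comPzRingType) (I : ideal (tilt pr R)).
Hypothesis radI : is_radical I.

(** Coordinate n is the p ^ n-th power of digit n, so for a radical ideal it is the same to ask that
    the digits or the coordinates lie in I. *)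
Lemma witt_idealP (a : witt pr (tilt pr R)) : witt_ideal I a <-> wmap (rproj I) a = 0.
Proof.
rewrite wmap_eq0; split=> [[x xI <-] n|h].
  apply/rproj_eq0 => /=; have : (0 < p ^ n)%N by rewrite expn_gt0 prime_gt0.
  by case: (p ^ n)%N => // k _; rewrite exprSr; exact: idlM.
exists (wdigit a); last exact: wdigitK.
by move=> n; apply: (radI (n := (p ^ n)%N)); rewrite trootK; exact/rproj_eq0/h.
Qed.

End WittIdeal.

Section Tilting.
Variables (p : nat) (pr : prime p) (R : comPzRingType).
Local Notation T := (tilt pr R).
Local Notation W := (witt pr T).
Local Notation xi t u := (teich pr t - p%:R * u).
Hypotheses (sepR : adic_separated (p%:R : R)) (cplR : adic_complete (p%:R : R)).

(** An element of the tilt of R/J is determined by its sequence of p-power roots, and [tmap]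
    projects such sequences termwise. *)
Lemma tilt_idealP (J : ideal R) (sepS : adic_separated (p%:R : rquot J))
    (cplS : adic_complete (p%:R : rquot J)) (x : T) :
  tilt_ideal pr J x <-> tmap (rproj J) x = 0.
Proof.
split=> [h|h n]; last first.
  apply/rproj_eq0; rewrite -(tseq_tmap (rproj J) sepR cplR sepS cplS) h.
  rewrite (@tseq_eq p pr _ sepS cplS (fun=> 0)) // => m; first exact: exp0p.
  by rewrite rmorph0.
apply: tilt_eq => n; rewrite (tcoord_tseq sepS cplS) (tseq_tmap _ sepR cplR sepS cplS).
by move/rproj_eq0: (h n) => /= ->; rewrite rmorph0.
Qed.

Lemma wmap_xi (S : comPzRingType) (g : {rmorphism T -> tilt pr S}) t u :
  wmap g (xi t u) = xi (g t) (wmap g u).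
Proof. by rewrite rmorphB rmorphM rmorph_nat; congr (_ - _); exact: wmap_teich. Qed.

Lemma tilt_small_unit (x y : T) : tcoord (x * y - 1) 0 = 0 -> exists z, x * z = 1.
Proof.
move=> h; have [|z zE] := @tilt_unit1B p pr R (1 - x * y).
  by rewrite -opprB -[LHS]/(- tcoord (x * y - 1) 0) h oppr0.
by exists (y * z); rewrite -zE; ring.
Qed.

(** Take lifts u of v and u' of v' along theta. As theta (u u' - 1) = 0, the product of their
    coordinates 0 is 1 up to an element vanishing in R/p. *)
Lemma exists_xi (t : T) (v v' : R) :
  (forall x : rquot (pideal (p%:R : R)), exists y, y ^+ p = x) ->
  v * v' = 1 -> sharp t = v * p%:R ->
  exists u u0, theta (xi t u) = 0 /\ wcoord u 0 * u0 = 1.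
Proof.
move=> frobR vv' tE.
have thp := theta_pX pr sepR cplR 1; rewrite !expr1 in thp.
have [u uE] := theta_surj pr sepR cplR frobR v.
have [u' u'E] := theta_surj pr sepR cplR frobR v'.
have [|u0 u0P] := @tilt_small_unit (wcoord u 0) (wcoord u' 0).
  have -> : wcoord u 0 * wcoord u' 0 - 1 = wcoord (u * u' - 1) 0.
    by rewrite -[RHS]/(wcoord0 _) rmorphB rmorphM rmorph1.
  rewrite -(theta_mod_p sepR cplR) thetaB // thetaM // theta1 // uE u'E vv' subrr.
  by rewrite rmorph0.
exists u, u0; split=> //.
by rewrite thetaB // thetaM // theta_teich // thp uE tE mulrC subrr.
Qed.

End Tilting.

Section PerfectoidIdeal.
Variables (p : nat) (pr : prime p) (R : comPzRingType) (J : ideal R).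
Local Notation T := (tilt pr R).
Local Notation g := (@tmap p pr _ _ (rproj J)).
Local Notation xi t u := (teich pr t - p%:R * u).
Hypotheses (sepR : adic_separated (p%:R : R)) (cplR : adic_complete (p%:R : R)).
Hypothesis frobR : forall x : rquot (pideal (p%:R : R)), exists y, y ^+ p = x.
Hypothesis perfS : perfectoid pr (rquot J).
Variables (t u0 : T) (u : witt pr T).
Hypothesis t0 : tcoord t 0 = 0.
Hypotheses (xi0 : theta (xi t u) = 0) (u_unit : wcoord u 0 * u0 = 1).

Let sepS := (perfectoid_adic perfS).1.
Let cplS := (perfectoid_adic perfS).2.

Lemma tmap_small0 : tcoord (g t) 0 = 0.
Proof. by rewrite /= t0 rmorph0. Qed.

(** The tilt of J is the kernel of g, whose target is reduced and (g t)-adically separated. *)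
Lemma tilt_ideal_closed_radical : closed_radical_ideal t (tilt_ideal pr J).
Proof.
have kerE := tilt_idealP sepR cplR sepS cplS.
split.
- split=> [|x y /kerE hx /kerE hy|a x /kerE hx]; apply/kerE.
  + exact: rmorph0.
  + by rewrite rmorphD /= hx hy addr0.
  + by rewrite rmorphM /= hx mulr0.
- by move=> x n /kerE; rewrite rmorphXn => /tilt_reduced h; exact/kerE.
- move=> x xcl; apply/kerE/(tilt_adic_separated tmap_small0) => n.
  have [y /kerE hy yx] := xcl n.
  by rewrite -rmorphXn -hy; exact/rmorph_eqmod/eqmod_sym.
Qed.

(** With the unit below, this makes [theta_kernel] and [tilt_kernel] available for R/J and the image
    of xi. *)
Let xiS0 : theta (xi (g t) (wmap g u)) = 0.
Proof. by rewrite -wmap_xi (theta_wmap _ sepR cplR sepS cplS) xi0 rmorph0. Qed.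

Let uS_unit : wcoord (wmap g u) 0 * g u0 = 1.
Proof. by rewrite -[LHS]rmorphM u_unit rmorph1. Qed.

Lemma tmap_rproj_surj s : exists x, g x = s.
Proof.
(* R^flat maps onto S/p, and an element of S^flat vanishing in S/p is a multiple of g t. *)
have step s' : exists x s1, s' = g x + g t * s1.
  have [y yE] := rproj_surj (tcoord s' 0); have [z zE] := rproj_surj y.
  have [x xE] := tcoord0_surj pr frobR (rproj _ z); exists x.
  have [|s1 s1E] := @tilt_kernel p pr _ perfS (g t) _ _ xiS0 uS_unit (s' - g x).
    by rewrite tcoordB /= xE rmodE /= zE yE subrr.
  by exists s1; rewrite -s1E addrC subrK.
have [x /choice [s1 xsE]] := choice step.
(* The iterated remainders of s yield the coefficients of a (g t)-adic expansion; their lifts form a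
   convergent t-adic series in R^flat. *)
have [l lP] := adic_complete_series (tilt_adic_complete t0) (fun k => x (iter k s1 s)).
exists l; apply: (adic_sep_eq (tilt_adic_separated tmap_small0)) => n.
rewrite -rmorphXn; apply: eqmod_trans (rmorph_eqmod _ (lP n)) _.
apply/eqmod_sym/eqmod_pideal; exists (iter n s1 s); rewrite rmorph_sum rmorphXn.
elim: n => [|n IH]; first by rewrite big_ord0 add0r mul1r.
rewrite big_ord_recr rmorphM rmorphXn iterS [LHS]IH [X in _ + _ * X = _](xsE (iter n s1 s)) exprS.
by rewrite mulrDr addrA mulrA -[g t * g t ^+ n]mulrC.
Qed.

Lemma untilt_tilt_ideal : untilt_ideal (tilt_ideal pr J) = J :> set R.
Proof.
have kerE := tilt_idealP sepR cplR sepS cplS.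
apply/seteqP; split=> x.
  move=> [a [b bJ <-] <-]; apply/rproj_eq0.
  rewrite -(theta_wmap _ sepR cplR sepS cplS) (_ : wmap _ _ = 0).
    exact: theta0 sepS cplS.
  apply/wmap_eq0 => n; have /kerE hb := bJ n.
  rewrite -[wcoord _ n]/(b n ^+ (p ^ n)) rmorphXn /= hb.
  have : (0 < p ^ n)%N by rewrite expn_gt0 prime_gt0.
  by case: (p ^ n)%N => // k _; rewrite exprS mul0r.
move=> Jx; have [a aE] := theta_surj pr sepR cplR frobR x.
have [|b bE] := theta_kernel perfS xiS0 uS_unit (w := wmap g a).
  by rewrite (theta_wmap _ sepR cplR sepS cplS) aE; exact/rproj_eq0.
have [c cE] := wmap_surj tmap_rproj_surj b.
pose d := a - xi t u * c.
have d0 : wmap g d = 0.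
  have e : wmap g a - wmap g (xi t u) * wmap g c = 0 by rewrite bE cE wmap_xi subrr.
  by rewrite rmorphB rmorphM.
exists d; last by rewrite /d thetaB // thetaM // xi0 mul0r subr0.
exists (wdigit d); last exact: wdigitK.
(* The coordinates of d are powers of its digits, so the digits also die in the reduced ring
   S^flat. *)
move=> n; apply/kerE; apply: (@tilt_reduced _ _ _ _ (p ^ n)).
by rewrite -rmorphXn trootK; move/wmap_eq0: d0; exact.
Qed.

End PerfectoidIdeal.

(** This computation and the next are kept over abstract rings, then applied to Witt vectors. *)
Lemma rmorph_affine (A B : comPzRingType) (f : {rmorphism A -> B}) q b i x c :
  f q = 0 -> f (q * b + i + x * c) = f i + f x * f c.
Proof. by move=> q0; rewrite !rmorphD !rmorphM q0 mul0r add0r. Qed.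

Lemma rmorph_affine0 (A B : comPzRingType) (f : {rmorphism A -> B}) n b i x x' q c :
  f i = 0 -> f x = x' -> f (q%:R ^+ n * b + i + x * c) = x' * f c + q%:R ^+ n * f b.
Proof.
by move=> i0 <-; rewrite !rmorphD !rmorphM rmorphXn rmorph_nat i0 addr0 addrC.
Qed.

(** * Untilting closed radical ideals *)

Section Untilting.
Variables (p : nat) (pr : prime p) (R : comPzRingType).
Local Notation T := (tilt pr R).
Local Notation W := (witt pr T).
Local Notation xi t u := (teich pr t - p%:R * u).
Hypotheses (sepR : adic_separated (p%:R : R)) (cplR : adic_complete (p%:R : R)).
Hypothesis frobR : forall x : rquot (pideal (p%:R : R)), exists y, y ^+ p = x.

(** W(I) is the kernel of a ring morphism because I is radical, and theta is surjective. *)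
Lemma untilt_is_ideal (I : ideal T) : is_radical I -> is_ideal (untilt_ideal I).
Proof.
move=> radI; have WI := witt_idealP radI; split.
- by exists 0; [apply/WI; exact: rmorph0 | exact: theta0].
- move=> _ _ [a /WI aI <-] [b /WI bI <-]; exists (a + b); last exact: thetaD.
  by apply/WI; rewrite rmorphD /= aI bI addr0.
- move=> x _ [a /WI aI <-]; have [b <-] := theta_surj pr sepR cplR frobR x.
  exists (b * a); last exact: thetaM.
  by apply/WI; rewrite rmorphM /= aI mulr0.
Qed.

Variables (t u0 : T) (u : W).
Hypothesis t0 : tcoord t 0 = 0.
Hypothesis kerR : forall w : W, theta w = 0 -> exists b, w = xi t u * b.
Hypotheses (xi0 : theta (xi t u) = 0) (u_unit : wcoord u 0 * u0 = 1).

Variable I : ideal T.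
Hypotheses (radI : is_radical I) (clI : adic_closed t I).

Let J := Ideal (untilt_is_ideal radI).
Local Notation S := (rquot J).
Local Notation g := (@tmap p pr _ _ (rproj J)).

Let WI := witt_idealP radI.

Lemma witt_ideal_wcoord0 (a : W) : witt_ideal I a -> I (wcoord0 a).
Proof. by move/WI/wmap_eq0 => h; exact/rproj_eq0/(h 0%N). Qed.

(** A congruence modulo theta(W(I)) and p ^ n lifts along theta, at the cost of a multiple of xi. *)
Lemma untilt_mod (a : W) n x : J (theta a - p%:R ^+ n * x) ->
  exists b i c, witt_ideal I i /\ a = p%:R ^+ n * b + i + xi t u * c.
Proof.
move=> [i iI iE]; have [b bE] := theta_surj pr sepR cplR frobR x.
have /eqmod_pideal [c cE] : eqmod (xi t u) a (p%:R ^+ n * b + i).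
  by apply: kerR; rewrite thetaB // thetaD // thetaM // theta_pX // bE iE; ring.
by exists b, i, c.
Qed.

Lemma sharp_untilt x : I x -> J (sharp x).
Proof.
move=> Ix; rewrite -theta_teich //; exists (teich pr x) => //.
apply/WI/wmap_eq0 => -[|n]; first exact/rproj_eq0.
exact: rmorph0.
Qed.

Lemma tcoord0_tmap x : tcoord (g x) 0 = rproj _ (rproj J (sharp x)).
Proof. by rewrite /= (tcoord_tseq sepR cplR) rmodE. Qed.

Lemma tcoord_tmap x n : tcoord (g x) n = tcoord (g (troot n x)) 0.
Proof. by []. Qed.

(** Coordinate n of g x is coordinate 0 for the p ^ n-th root of x. That root lies in I + (t), and
    the p ^ n-th power is additive. *)
Lemma tcoord_tmap_eq0 x n : tcoord (g x) n = 0 -> exists r, I (x - t ^+ (p ^ n) * r).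
Proof.
rewrite tcoord_tmap tcoord0_tmap => /rproj_eq0 [y yE].
have [z zE] := rproj_surj y.
have Jx : J (theta (teich pr (troot n x)) - p%:R ^+ 1 * z).
  apply/rproj_eq0; rewrite theta_teich // rmorphB rmorphM rmorphXn rmorph_nat expr1 /=.
  by rewrite zE -yE subrr.
have [b [i [c [/witt_ideal_wcoord0 iI]]]] := untilt_mod Jx.
move/(congr1 (@wcoord0 p pr T)) => xE.
have e : wcoord0 (p%:R ^+ 1 * b + i + xi t u * c) = wcoord0 i + wcoord0 (xi t u) * wcoord0 c.
  exact: (rmorph_affine _ _ _ _ (@wcoord0_p p pr R)).
rewrite e wcoord0_Bp !wcoord0_teich in xE.
exists (wcoord0 c ^+ (p ^ n)).
have := trootK n x; rewrite xE tilt_frobXD exprMn => <-.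
rewrite addrK; have : (0 < p ^ n)%N by rewrite expn_gt0 prime_gt0.
by case: (p ^ n)%N => // k _; rewrite exprSr; exact: idlM.
Qed.

(** The intersection of the ideals I + (t ^ (p ^ n)) is I because I is closed. Conversely, the
    radical ideal I contains all p-power roots of its elements. *)
Lemma tmap_eq0 x : g x = 0 <-> I x.
Proof.
split=> [gx0|Ix].
  apply: clI => n; have [|r rI] := @tcoord_tmap_eq0 x n; first by rewrite gx0.
  exists (x - t ^+ (p ^ n) * r) => //.
  apply: (eqmod_le (ltnW (ltn_expl n (prime_gt1 pr)))).
  by exists (- r); rewrite mulrN addrAC subrr add0r.
apply: tilt_eq => n; rewrite tcoord_tmap tcoord0_tmap.
have Ir : I (troot n x) by apply: (radI (n := (p ^ n)%N)); rewrite trootK.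
by move/sharp_untilt/rproj_eq0: Ir => /= ->; rewrite rmorph0.
Qed.

Lemma tmap_untilt_surj s : exists x, g x = s.
Proof.
have lift n : exists r, tcoord (g r) n = tcoord s n.
  have [y yE] := rproj_surj (tcoord s n); have [z zE] := rproj_surj y.
  have [r rE] := tcoord0_surj pr frobR (rproj _ z); exists (r ^+ (p ^ n)).
  by rewrite rmorphXn tcoordX (tcoord_exp _ n 0) /= rE rmodE /= zE.
have [z zE] := choice lift.
have zE' m n : (m <= n)%N -> tcoord (g (z n)) m = tcoord s m.
  by move=> /subnKC mn; rewrite -(tcoord_exp s (n - m)) -(tcoord_exp (g _) (n - m)) mn zE.
have step n : exists c, I (z n.+1 - z n - t ^+ (p ^ n) * c).
  by apply: tcoord_tmap_eq0; rewrite rmorphB tcoordB !zE' // subrr.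
have [c cI] := choice step.
(* The lifts z n need not converge. Dropping the parts of their increments that lie in I gives a
   t-adic Cauchy sequence y with the same images under g. *)
pose y n := z 0%N + \sum_(k < n) t ^+ (p ^ k) * c k.
have yS n : y n.+1 = y n + t ^+ (p ^ n) * c n by rewrite /y big_ord_recr addrA.
have yI n : I (z n - y n).
  elim: n => [|n IH]; first by rewrite /y big_ord0 addr0 subrr; exact: idl0.
  have -> : z n.+1 - y n.+1 = (z n.+1 - z n - t ^+ (p ^ n) * c n) + (z n - y n).
    by rewrite yS; ring.
  exact: idlD.
have [n|l lP] := tilt_adic_complete t0 (u := y).
  apply: (eqmod_le (ltnW (ltn_expl n (prime_gt1 pr)))).
  by exists (c n); rewrite yS addrAC subrr add0r.
(* The index p ^ m is chosen so that t ^ n vanishes in coordinate m, where l and y n then agree. *)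
exists l; apply: tilt_eq => m; pose n := (p ^ m)%N.
rewrite -(zE' m n); last by rewrite ltnW // ltn_expl // prime_gt1.
have /tmap_eq0 := yI n; rewrite rmorphB => /eqP; rewrite subr_eq0 => /eqP ->.
have [d dE] := lP n; apply/esym/eqP; rewrite -subr_eq0 -tcoordB -rmorphB; apply/eqP.
by rewrite dE /= tcoord_small // mul0r rmorph0.
Qed.

Lemma wmap_witt_ideal a : wmap g a = 0 <-> witt_ideal I a.
Proof.
by rewrite WI !wmap_eq0; split=> h n; [apply/rproj_eq0/tmap_eq0 | apply/tmap_eq0/rproj_eq0];
  exact: h.
Qed.

(** If theta(a) maps into every p ^ n S, the image of a in W(S^flat) lies in (xi) + (p ^ n) for all
    n, hence in (xi) by [distinguished_closed]. *)
Lemma untilt_adic_separated : adic_separated (p%:R : S).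
Proof.
move=> x xP; have [y yE] := rproj_surj x; have [a aE] := theta_surj pr sepR cplR frobR y.
have h n : exists b z, wmap g a = xi (g t) (wmap g u) * b + p%:R ^+ n * z.
  have [z' /eqP] := xP n; have [z <-] := rproj_surj z'.
  rewrite subr0 -yE -(rmorph_nat (rproj J)) -rmorphXn -rmorphM -subr_eq0 -rmorphB.
  move/eqP/rproj_eq0; rewrite -aE => /untilt_mod [b [i [c [/wmap_witt_ideal i0 ->]]]].
  exists (wmap g c), (wmap g b).
  exact: rmorph_affine0 i0 (wmap_xi _ _ _).
have uS_unit : wcoord0 (wmap g u) * g u0 = 1.
  by have := congr1 g u_unit; rewrite rmorphM rmorph1.
have [b bE] := distinguished_closed (@teich0 p pr _) (@teichM p pr _)
  (@wcoord0_teich p pr _) (wcoord0_p _ _) (@witt_p_inj p pr _) (@witt_split p pr _)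
  uS_unit (@tilt_reduced p pr _) (@witt_adic_separated p pr _) (@witt_adic_complete p pr _) h.
have [c cE] := wmap_surj tmap_untilt_surj b.
rewrite -yE -aE; apply/rproj_eq0; exists (a - xi t u * c).
  apply/wmap_witt_ideal.
  have e : wmap g a - wmap g (xi t u) * wmap g c = 0 by rewrite bE cE wmap_xi subrr.
  by rewrite rmorphB rmorphM.
by rewrite thetaB // thetaM // xi0 mul0r subr0.
Qed.

Lemma untilt_adic_complete : adic_complete (p%:R : S).
Proof. by rewrite -(rmorph_nat (rproj J)); exact: rquot_adic_complete. Qed.

Lemma theta_untilt w : theta (wmap g w) = rproj J (theta w).
Proof. exact: theta_wmap sepR cplR untilt_adic_separated untilt_adic_complete w. Qed.

Lemma untilt_perfectoid (v v' pi : R) : v * v' = 1 -> pi ^+ p = v * p%:R ->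
  perfectoid pr S.
Proof.
move=> vv' piE; exists (rproj J pi).
have piE' : rproj J pi ^+ p = rproj J v * p%:R by rewrite -rmorphXn piE rmorphM rmorph_nat.
have vvS : rproj J v * rproj J v' = 1 by rewrite -rmorphM vv' rmorph1.
split.
- exact: adic_separated_root piE' untilt_adic_separated.
- exact: (adic_complete_root vvS (prime_gt0 pr) piE' untilt_adic_complete).
- by exists (rproj J v'); rewrite piE' mulrAC vvS mul1r.
- move=> x; have [y <-] := rproj_surj x; have [z <-] := rproj_surj y.
  have [r rE] := frobR (rproj _ z); exists (rmod (p := p) (rproj J) r).
  by have := congr1 (rmod (p := p) (rproj J)) rE; rewrite rmodE rmorphXn.
exists (wmap g (xi t u)); apply/seteqP; split=> [w|_ [c ->]] /=; last first.
  have [b <-] := wmap_surj tmap_untilt_surj c.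
  by rewrite -rmorphM theta_untilt thetaM // xi0 mul0r rmorph0.
(* If theta(a) = theta(i) with i in W(I), then a - i is a multiple of xi, and i maps to 0 in
   W(S^flat). *)
have [a <-] := wmap_surj tmap_untilt_surj w; rewrite theta_untilt => /rproj_eq0.
move=> [i /wmap_witt_ideal i0 iE].
have [|c cE] := kerR (w := a - i); first by rewrite thetaB // iE subrr.
exists (wmap g c).
have e : wmap g a - wmap g i = wmap g (xi t u) * wmap g c by rewrite -rmorphB cE rmorphM.
by rewrite -e i0 subr0.
Qed.

(** Both sides are the kernel of g. *)
Lemma tilt_untilt_ideal : tilt_ideal pr (untilt_ideal I) = I :> set T.
Proof.
apply/seteqP; split=> x.
  by move/(tilt_idealP sepR cplR untilt_adic_separated untilt_adic_complete)/tmap_eq0.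
by move/tmap_eq0/(tilt_idealP sepR cplR untilt_adic_separated untilt_adic_complete).
Qed.

End Untilting.

(** * The tilting correspondence for perfectoid ideals *)

Theorem theorem3p5 (p : nat) (pr : prime p) (R : comPzRingType)
    (perfR : perfectoid pr R)
    (char0 : forall n : nat, n%:R = 0 :> R -> n = 0%N)
    (v : R) (v_unit : exists v' : R, v * v' = 1)
    (w : nat -> R) (wP : ppow_system p w) (w0 : w 0%N = v * p%:R) :
  let pflat := tilt_of pr wP in
  [/\ forall J : set R, perfectoid_ideal pr J ->
        closed_radical_ideal pflat (tilt_ideal pr J),
      forall I : set (tilt pr R), closed_radical_ideal pflat I ->
        perfectoid_ideal pr (untilt_ideal I),
      forall J : set R, perfectoid_ideal pr J -> untilt_ideal (tilt_ideal pr J) = J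
    & forall I : set (tilt pr R), closed_radical_ideal pflat I ->
        tilt_ideal pr (untilt_ideal I) = I].
Proof.
move=> pflat; have [sepR cplR] := perfectoid_adic perfR.
have [_ [_ _ _ frobR _]] := perfR; have [v' vv'] := v_unit.
have t0 : tcoord pflat 0 = 0.
  by apply/rproj_eq0; exists v; rewrite w0 mulrC.
have sharpE : sharp pflat = v * p%:R by rewrite /sharp tseq_tilt_of.
have [u [u0 [xi0 u_unit]]] := exists_xi sepR cplR frobR vv' sharpE.
have kerR := theta_kernel perfR xi0 u_unit.
split.
- by move=> J [idJ perfS]; exact: (tilt_ideal_closed_radical (J := Ideal idJ) sepR cplR perfS t0).
- move=> I [idI radI clI].
  exists (untilt_is_ideal sepR cplR frobR (I := Ideal idI) radI).
  (* The element pi of the quotient is the image of the chosen p-th root of v p. *)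
  have piE : w 1%N ^+ p = v * p%:R by rewrite wP.
  exact: (untilt_perfectoid (I := Ideal idI) sepR cplR frobR t0 kerR xi0 u_unit radI clI vv' piE).
- move=> J [idJ perfS].
  exact: (untilt_tilt_ideal sepR cplR frobR perfS t0 xi0 u_unit).
- move=> I [idI radI clI].
  exact: (tilt_untilt_ideal (I := Ideal idI) sepR cplR frobR t0 kerR xi0 u_unit radI clI).
Qed.
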